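(* \textsc{Temporal Matching} can be solved in $k^{O(k)}\cdot|\mathcal G|$ time, where $k$ is the desired matching size and $\mathcal G$ the input temporal graph.
   Context: A temporal graph $\mathcal G=(G,\lambda)$ consists of a static graph $G=(V,E)$ and a labeling $\lambda:E\to 2^{\mathbb N}\setminus\{\emptyset\}$, given as explicit label lists in ascending order; its lifetime is $T=\max\{t\in\lambda(e)\}$ and its size is $|\mathcal G|=|V|+\sum_{t=1}^T|E_t|$ with $E_t=\{e\in E:t\in\lambda(e)\}$. A time edge is a pair $(e,t)$ with $t\in\lambda(e)$. For $\Delta\in\mathbb N$, a $\Delta$-temporal matching is a set of time edges such that any two distinct ones $(e,t),(e',t')$ satisfy $e\cap e'=\emptyset$ or $|t-t'|\ge\Delta$. \textsc{Temporal Matching}: given $\mathcal G$, $\Delta$, $k$, decide whether $\mathcal G$ has a $\Delta$-temporal matching of size at least $k$. *)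

(* Defs.v *)
From mathcomp Require Import all_boot all_order all_algebra.
From mathcomp Require Import finmap.

Set Implicit Arguments.
Unset Strict Implicit.
Unset Printing Implicit Defensive.

Import IntDist.
Local Open Scope nat_scope.

(** * Temporal graphs and temporal matchings *)

(* The vertices are numbered 0, ..., tg_n - 1.  A label set is its ascending
   list of elements; the values of tg_label outside tg_edges are irrelevant.
   Time steps are positive, so that every time edge lies in one of the layers
   E_1, ..., E_T counted by tg_size. *)
Record temporal_graph := TemporalGraph {
  tg_n : nat;
  tg_edges : {set {set 'I_tg_n}};
  tg_label : {set 'I_tg_n} -> seq nat;
  tg_edge_card : forall e, e \in tg_edges -> #|e| = 2;
  tg_label_neq0 : forall e, e \in tg_edges -> tg_label e <> [::];
  tg_label_sorted : forall e, e \in tg_edges -> sorted ltn (tg_label e);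
  tg_label_pos : forall e t, e \in tg_edges -> t \in tg_label e -> 0 < t
}.

Definition lifetime (G : temporal_graph) : nat :=
  \max_(e in tg_edges G) \max_(t <- tg_label e) t.

Definition layer (G : temporal_graph) (t : nat) : {set {set 'I_(tg_n G)}} :=
  [set e in tg_edges G | t \in tg_label e].

Definition tg_size (G : temporal_graph) : nat :=
  tg_n G + \sum_(1 <= t < (lifetime G).+1) #|layer G t|.

Definition time_edge (G : temporal_graph) (p : {set 'I_(tg_n G)} * nat) : bool :=
  (p.1 \in tg_edges G) && (p.2 \in tg_label p.1).

Definition temporal_matching (G : temporal_graph) (Delta : nat)
    (M : {fset {set 'I_(tg_n G)} * nat}) : Prop :=
  (forall p, p \in M -> time_edge p) /\
  (forall p q, p \in M -> q \in M -> p <> q ->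
     p.1 :&: q.1 = set0 \/ Delta <= `|p.2 - q.2|).

Definition temporal_matching_yes (G : temporal_graph) (Delta k : nat) : Prop :=
  exists M : {fset {set 'I_(tg_n G)} * nat},
    temporal_matching Delta M /\ k <= #|` M|.

(** * Input words *)

(* es lists every edge exactly once, in any order and with its end points in
   either order. *)
Definition edge_listing (G : temporal_graph)
    (es : seq ('I_(tg_n G) * 'I_(tg_n G))) : bool :=
  perm_eq [seq [set e.1; e.2] | e <- es] (enum (tg_edges G)).

Definition edge_word (G : temporal_graph) (e : 'I_(tg_n G) * 'I_(tg_n G)) :
    seq nat :=
  let l := tg_label [set e.1; e.2] in
  [:: val e.1, val e.2, size l & l].

Definition instance_word (G : temporal_graph)
    (es : seq ('I_(tg_n G) * 'I_(tg_n G))) (Delta k : nat) : seq nat :=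
  [:: tg_n G, size es, Delta, k & flatten [seq edge_word e | e <- es]].

(** * Random access machines under the uniform cost criterion *)

(* A state has registers, addressed by constants of the program, and a memory,
   addressed by register contents.  All cells hold natural numbers; the only
   arithmetic is addition and truncated subtraction, so the length of a number
   grows by at most one bit per step. *)
Record ram_state := RamState { reg : nat -> nat; mem : nat -> nat }.

Definition upd (f : nat -> nat) (i v : nat) : nat -> nat :=
  fun j => if j == i then v else f j.

Definition set_reg (s : ram_state) (r v : nat) : ram_state :=
  RamState (upd (reg s) r v) (mem s).

Definition set_mem (s : ram_state) (a v : nat) : ram_state :=
  RamState (reg s) (upd (mem s) a v).

Inductive ram_instr :=
| IConst of nat & nat       (* IConst r c : r := c *)
| IMove of nat & nat        (* IMove r x : r := x *)
| IAdd of nat & nat & nat   (* IAdd r x y : r := x + y *)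
| ISub of nat & nat & nat   (* ISub r x y : r := x - y *)
| ILoad of nat & nat        (* ILoad r x : r := mem[x] *)
| IStore of nat & nat.      (* IStore x y : mem[x] := y *)

Definition ram_step (i : ram_instr) (s : ram_state) : ram_state :=
  match i with
  | IConst r c => set_reg s r c
  | IMove r x => set_reg s r (reg s x)
  | IAdd r x y => set_reg s r (reg s x + reg s y)
  | ISub r x y => set_reg s r (reg s x - reg s y)
  | ILoad r x => set_reg s r (mem s (reg s x))
  | IStore x y => set_mem s (reg s x) (reg s y)
  end.

Inductive ram_prog :=
| Instr of ram_instr
| Seq of ram_prog & ram_prog
| If of nat & ram_prog & ram_prog
| While of nat & ram_prog.

(* ram_exec P s t s' : started in s, the program P halts in s' after t steps;
   every instruction and every test of a register against 0 is one step. *)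
Inductive ram_exec : ram_prog -> ram_state -> nat -> ram_state -> Prop :=
| ExecInstr i s : ram_exec (Instr i) s 1 (ram_step i s)
| ExecSeq P Q s t s' u s'' :
    ram_exec P s t s' -> ram_exec Q s' u s'' ->
    ram_exec (Seq P Q) s (t + u) s''
| ExecIfTrue r P Q s t s' :
    reg s r <> 0 -> ram_exec P s t s' -> ram_exec (If r P Q) s t.+1 s'
| ExecIfFalse r P Q s t s' :
    reg s r = 0 -> ram_exec Q s t s' -> ram_exec (If r P Q) s t.+1 s'
| ExecWhileTrue r P s t s' u s'' :
    reg s r <> 0 -> ram_exec P s t s' -> ram_exec (While r P) s' u s'' ->
    ram_exec (While r P) s (t + u).+1 s''
| ExecWhileFalse r P s : reg s r = 0 -> ram_exec (While r P) s 1 s.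

Lemma ram_exec_det P s t1 s1 t2 s2 :
  ram_exec P s t1 s1 -> ram_exec P s t2 s2 -> t1 = t2 /\ s1 = s2.
Proof.
move=> H; elim: H t2 s2 => {P s t1 s1};
  intros; match goal with K : ram_exec _ _ _ _ |- _ =>
    inversion K; subst; clear K end => //;
  repeat match goal with
  | IH : forall t u, ram_exec ?P ?s t u -> _, K : ram_exec ?P ?s _ _ |- _ =>
    case: (IH _ _ K) => ? ?; subst; clear K
  end => //.
Qed.

Definition ram_init (w : seq nat) : ram_state :=
  RamState (fun _ => 0) (fun a => nth 0 w a).

(* The answer is read off register 0: nonzero for yes, zero for no. *)
Definition decides_within (P : ram_prog) (w : seq nat) (yes : Prop) (b : nat) :
    Prop :=
  exists t s, [/\ ram_exec P (ram_init w) t s, t <= b & reg s 0 <> 0 <-> yes].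

(* Main.v *)
Require Import Defs.
From mathcomp Require Import all_boot finmap all_algebra zify ring.
Import Defs IntDist.

Set Implicit Arguments.
Unset Strict Implicit.
Unset Printing Implicit Defensive.

Local Open Scope nat_scope.

(* A maximum matching is built by repeatedly choosing a time edge that does not
   conflict with the chosen ones.  Let (e, t0) be the earliest such time edge
   and u an end point of e.  An exchange argument shows that some optimal
   completion contains one of the first 2k candidates at u, where candidates
   are taken in order of time and after each one the time edges at its other
   end point are skipped during a Delta-window: if the completion has an element
   (uw, t) at u with t < t0 + Delta, then either w was skipped because of an
   earlier copy of uw, or the 2k candidates precede t and reach distinct
   vertices, one of which is not covered by the rest of the completion; and
   otherwise at most one of its elements conflicts with the first candidate.
   The algorithm tries all (2k)^k sequences of k choices, and each choice needs
   at most 2k + 1 scans of the input.  For Delta = 0 there are no conflicts, and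
   it suffices to count the time edges. *)

(** * A structured language compiled to random access machines *)

Inductive exp :=
| EVar of nat
| ECst of nat
| EAdd of exp & exp
| ESub of exp & exp
| ELoad of exp.

Fixpoint eval (s : ram_state) (e : exp) : nat :=
  match e with
  | EVar x => reg s x
  | ECst c => c
  | EAdd a b => eval s a + eval s b
  | ESub a b => eval s a - eval s b
  | ELoad a => mem s (eval s a)
  end.

Fixpoint ecost (e : exp) : nat :=
  match e with
  | EVar _ | ECst _ => 1
  | EAdd a b | ESub a b => ecost a + (ecost b + 1)
  | ELoad a => ecost a + 1
  end.

Fixpoint wf_exp (V : nat) (e : exp) : bool :=
  match e with
  | EVar x => x < V
  | ECst _ => true
  | EAdd a b | ESub a b => wf_exp V a && wf_exp V b
  | ELoad a => wf_exp V a
  end.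

Inductive cmd :=
| Asg of nat & exp
| Sto of exp & exp
| Sq of cmd & cmd
| For of exp & cmd.

(* [For e c] evaluates [e] once; its loop counter is invisible to [c]. *)
Fixpoint den (c : cmd) (s : ram_state) : ram_state :=
  match c with
  | Asg x e => set_reg s x (eval s e)
  | Sto a e => set_mem s (eval s a) (eval s e)
  | Sq c1 c2 => den c2 (den c1 s)
  | For e c => iter (eval s e) (den c) s
  end.

(** Each round pays for the body, two instructions that decrement the counter and one test; the
    last, failing test is the remaining 1. *)
Fixpoint iter_cost (f : ram_state -> ram_state) (g : ram_state -> nat) n s :=
  if n is n'.+1 then (g s + 2 + iter_cost f g n' (f s)).+1 else 1.

Fixpoint cost (c : cmd) (s : ram_state) : nat :=
  match c with
  | Asg _ e => ecost e + 1
  | Sto a e => ecost a + (ecost e + 1)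
  | Sq c1 c2 => cost c1 s + cost c2 (den c1 s)
  | For e c => ecost e + iter_cost (den c) (cost c) (eval s e) s
  end.

Fixpoint wf_cmd (V : nat) (c : cmd) : bool :=
  match c with
  | Asg x e => (x < V) && wf_exp V e
  | Sto a e => wf_exp V a && wf_exp V e
  | Sq c1 c2 => wf_cmd V c1 && wf_cmd V c2
  | For e c => wf_exp V e && wf_cmd V c
  end.

(* The value is computed in register [d], with scratch registers above it. *)
Fixpoint compile_exp (e : exp) (d : nat) : ram_prog :=
  match e with
  | EVar x => Instr (IMove d x)
  | ECst c => Instr (IConst d c)
  | EAdd a b => Seq (compile_exp a d)
                  (Seq (compile_exp b d.+1) (Instr (IAdd d d d.+1)))
  | ESub a b => Seq (compile_exp a d)
                  (Seq (compile_exp b d.+1) (Instr (ISub d d d.+1)))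
  | ELoad a => Seq (compile_exp a d) (Instr (ILoad d d))
  end.

(** A loop counter lives in register [d] and the body is compiled from [d.+1] on, so nested loops
    have disjoint counters. After the body, [d.+1] is free again and holds the 1 to be
    subtracted. *)
Fixpoint compile (c : cmd) (d : nat) : ram_prog :=
  match c with
  | Asg x e => Seq (compile_exp e d) (Instr (IMove x d))
  | Sto a e => Seq (compile_exp a d)
                 (Seq (compile_exp e d.+1) (Instr (IStore d d.+1)))
  | Sq c1 c2 => Seq (compile c1 d) (compile c2 d)
  | For e c => Seq (compile_exp e d)
      (While d (Seq (compile c d.+1)
         (Seq (Instr (IConst d.+1 1)) (Instr (ISub d d d.+1)))))
  end.

(** Registers from [V] on are private to the compiled code, hence unconstrained. *)
Definition agree (V : nat) (s sg : ram_state) : Prop :=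
  (forall r, r < V -> reg sg r = reg s r) /\ mem sg =1 mem s.

Lemma updE f i v j : upd f i v j = if j == i then v else f j.
Proof. by []. Qed.

Lemma upd_same f i v : upd f i v i = v.
Proof. by rewrite updE eqxx. Qed.

Lemma upd_neq f i v j : j != i -> upd f i v j = f j.
Proof. by rewrite updE => /negPf ->. Qed.

Lemma compile_expP V s e d sg : wf_exp V e -> V <= d -> agree V s sg ->
  exists sg', [/\ ram_exec (compile_exp e d) sg (ecost e) sg',
    reg sg' d = eval s e, mem sg' = mem sg &
    forall r, r < d -> reg sg' r = reg sg r].
Proof.
(* Addition and subtraction share this argument; [op] is the operation and [I] its instruction. *)
have bin (op : nat -> nat -> nat) (I : nat -> nat -> nat -> ram_instr) a b :
    (forall r x y sg, ram_step (I r x y) sg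
       = set_reg sg r (op (reg sg x) (reg sg y))) ->
    (forall d sg, wf_exp V a -> V <= d -> agree V s sg ->
      exists sg', [/\ ram_exec (compile_exp a d) sg (ecost a) sg',
      reg sg' d = eval s a, mem sg' = mem sg &
      forall r, r < d -> reg sg' r = reg sg r]) ->
    (forall d sg, wf_exp V b -> V <= d -> agree V s sg ->
      exists sg', [/\ ram_exec (compile_exp b d) sg (ecost b) sg',
      reg sg' d = eval s b, mem sg' = mem sg &
      forall r, r < d -> reg sg' r = reg sg r]) ->
    forall d sg, wf_exp V a && wf_exp V b -> V <= d -> agree V s sg ->
      exists sg', [/\ ram_exec (Seq (compile_exp a d)
        (Seq (compile_exp b d.+1) (Instr (I d d d.+1)))) sg
          (ecost a + (ecost b + 1)) sg',
      reg sg' d = op (eval s a) (eval s b), mem sg' = mem sg &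
      forall r, r < d -> reg sg' r = reg sg r].
  move=> IE IHa IHb {}d {}sg /andP[wa wb] Vd [Hr Hm].
  have [s1 [E1 v1 m1 f1]] := IHa d sg wa Vd (conj Hr Hm).
  have A1 : agree V s s1.
    by split=> [r rV|x]; [rewrite f1 ?Hr //; lia | rewrite m1 Hm].
  have [s2 [E2 v2 m2 f2]] := IHb d.+1 s1 wb (leqW Vd) A1.
  exists (ram_step (I d d d.+1) s2); split.
  - by apply: ExecSeq E1 _; apply: ExecSeq E2 _; apply: ExecInstr.
  - by rewrite IE /= upd_same v2 f2 // v1.
  - by rewrite IE /= m2 m1.
  - by move=> r rd; rewrite IE /= upd_neq ?f2 ?f1 //; lia.
elim: e d sg => [x|c|a IHa b IHb|a IHa b IHb|a IHa] d sg /=.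
- move=> xV Vd [Hr Hm]; exists (ram_step (IMove d x) sg).
  split; [exact: ExecInstr | by rewrite /= upd_same Hr | by [] |].
  by move=> r rd; rewrite /= upd_neq //; lia.
- move=> _ Vd _; exists (ram_step (IConst d c) sg).
  split; [exact: ExecInstr | by rewrite /= upd_same | by [] |].
  by move=> r rd; rewrite /= upd_neq //; lia.
- exact: (bin addn IAdd).
- exact: (bin subn ISub).
- move=> wa Vd [Hr Hm].
  have [s1 [E1 v1 m1 f1]] := IHa d sg wa Vd (conj Hr Hm).
  exists (ram_step (ILoad d d) s1); split.
  - by apply: ExecSeq E1 _; apply: ExecInstr.
  - by rewrite /= upd_same v1 m1 Hm.
  - by rewrite /= m1.
  - by move=> r rd; rewrite /= upd_neq ?f1 //; lia.
Qed.

(** The last clause carries the induction through loops: a body compiled above [d] leaves the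
    counters of the enclosing loops alone. *)
Lemma compileP V c s d sg : wf_cmd V c -> V <= d -> agree V s sg ->
  exists sg', [/\ ram_exec (compile c d) sg (cost c s) sg',
    agree V (den c s) sg' &
    forall r, V <= r < d -> reg sg' r = reg sg r].
Proof.
elim: c s d sg => [x e|a e|c1 IH1 c2 IH2|e c IH] s d sg /=.
- move=> /andP[xV we] Vd A.
  have [s1 [E1 v1 m1 f1]] := compile_expP we Vd A; case: A => Hr Hm.
  exists (ram_step (IMove x d) s1); split.
  - by apply: ExecSeq E1 _; apply: ExecInstr.
  - split=> [r rV|y] /=; last by rewrite m1 Hm.
    by rewrite !updE v1; case: eqP => // _; rewrite f1 ?Hr //; lia.
  - by move=> r rd; rewrite /= upd_neq ?f1 //; lia.
- move=> /andP[wa we] Vd A.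
  have [s1 [E1 v1 m1 f1]] := compile_expP wa Vd A; case: A => Hr Hm.
  have A1 : agree V s s1.
    by split=> [r rV|y]; [rewrite f1 ?Hr //; lia | rewrite m1 Hm].
  have [s2 [E2 v2 m2 f2]] := compile_expP we (leqW Vd) A1.
  exists (ram_step (IStore d d.+1) s2); split.
  - by apply: ExecSeq E1 _; apply: ExecSeq E2 _; apply: ExecInstr.
  - split=> [r rV|y] /=; first by rewrite f2 ?f1 ?Hr //; lia.
    by rewrite !updE v2 f2 // v1; case: eqP => // _; rewrite m2 m1 Hm.
  - by move=> r rd; rewrite /= f2 ?f1 //; lia.
- move=> /andP[w1 w2] Vd A.
  have [s1 [E1 A1 f1]] := IH1 _ _ _ w1 Vd A.
  have [s2 [E2 A2 f2]] := IH2 _ _ _ w2 Vd A1.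
  exists s2; split=> //; first exact: ExecSeq E1 E2.
  by move=> r rd; rewrite f2 ?f1.
- move=> /andP[we wc] Vd A.
  have [s1 [E1 v1 m1 f1]] := compile_expP we Vd A; case: A => Hr Hm.
  have A1 : agree V s s1.
    by split=> [r rV|y]; [rewrite f1 ?Hr //; lia | rewrite m1 Hm].
  suff: exists sg', [/\ ram_exec (While d (Seq (compile c d.+1)
         (Seq (Instr (IConst d.+1 1)) (Instr (ISub d d d.+1))))) s1
         (iter_cost (den c) (cost c) (eval s e) s) sg',
       agree V (iter (eval s e) (den c) s) sg' &
       forall r, V <= r < d -> reg sg' r = reg s1 r].
    case=> s2 [E2 A2 f2]; exists s2; split=> //; first exact: ExecSeq E1 E2.
    by move=> r rd; rewrite f2 ?f1 //; lia.
  (* From here on, register [d] holds the number of rounds still to run. *)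
  move: (eval s e) v1 => n v1 {E1 m1 f1 Hr Hm sg}.
  elim: n s s1 A1 v1 => [|n IHn] s s1 A1 v1.
    by exists s1; split=> //; apply: ExecWhileFalse.
  have [s2 [E2 A2 f2]] := IH s d.+1 s1 wc (leqW Vd) A1.
  pose s3 := ram_step (ISub d d d.+1) (ram_step (IConst d.+1 1) s2).
  have A3 : agree V (den c s) s3.
    case: A2 => Hr Hm; split=> [r rV|y] /=; last exact: Hm.
    by rewrite !upd_neq ?Hr //; lia.
  have v3 : reg s3 d = n.
    rewrite /= !upd_same upd_neq ?neq_ltn ?leqnn // f2 ?v1 ?subn1 //; lia.
  have [s4 [E4 A4 f4]] := IHn _ _ A3 v3.
  exists s4; split.
  - rewrite [iter_cost _ _ _ _]/=; apply: ExecWhileTrue E4; first by rewrite v1.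
    apply: ExecSeq E2 _; apply: (@ExecSeq _ _ _ 1 _ 1); exact: ExecInstr.
  - by rewrite iterSr.
  - move=> r rd; rewrite f4 // /= !upd_neq ?f2 //; lia.
Qed.

(** * Cost and invariant rules for loops *)

Lemma iter_costP (c : cmd) (I : nat -> ram_state -> Prop) (b n : nat) s :
  (forall i s, i < n -> I i s -> cost c s <= b /\ I i.+1 (den c s)) -> I 0 s ->
  iter_cost (den c) (cost c) n s <= n * (b + 3) + 1 /\ I n (iter n (den c) s).
Proof.
elim: n I s => [|n IH] I s step I0 //.
have [cb I1] := step 0 s (ltn0Sn _) I0.
(* Peeling off the first round shifts the invariant by one index. *)
have [] := IH (fun i => I i.+1) (den c s) _ I1.
  by move=> i s' lin; apply: step.
rewrite iterSr /= => Hc HI; split=> //; lia.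
Qed.

Lemma forP (c : cmd) (I : nat -> ram_state -> Prop) (b n : nat) e s :
  eval s e = n -> I 0 s ->
  (forall i s, i < n -> I i s -> cost c s <= b /\ I i.+1 (den c s)) ->
  cost (For e c) s <= ecost e + n * (b + 3) + 1 /\ I n (den (For e c) s).
Proof.
move=> /= -> I0 step; have [H1 H2] := iter_costP step I0; split=> //; lia.
Qed.

(** The invariant speaks of the prefix done and the suffix left. Costs are charged per element, so
    nested loops are bounded by the total length of the inner lists and not by a product of
    maxima. *)
Lemma for_seqP (X : Type) (c : cmd) (I : seq X -> seq X -> ram_state -> Prop)
    (b : X -> nat) e (xs : seq X) s :
  eval s e = size xs -> I [::] xs s ->
  (forall l x r s, I l (x :: r) s ->
     cost c s <= b x /\ I (rcons l x) r (den c s)) ->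
  cost (For e c) s <= ecost e + sumn [seq b x + 3 | x <- xs] + 1 /\
  I xs [::] (den (For e c) s).
Proof.
move=> /= -> I0 step.
suff: forall l s, I l xs s ->
    iter_cost (den c) (cost c) (size xs) s <= sumn [seq b x + 3 | x <- xs] + 1
    /\ I (l ++ xs) [::] (iter (size xs) (den c) s).
  by case/(_ _ _ I0) => H1 H2; split=> //; lia.
elim: xs {I0 s} => [|x xs IH] l s Il; first by rewrite cats0.
have [cb I1] := step _ _ _ _ Il; have [] := IH _ _ I1.
by rewrite cat_rcons -iterSr /= => Hc HI; split=> //; lia.
Qed.

(** * Frame properties of commands *)

Fixpoint writes (c : cmd) : seq nat :=
  match c with
  | Asg x _ => [:: x]
  | Sto _ _ => [::]
  | Sq c1 c2 => writes c1 ++ writes c2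
  | For _ c => writes c
  end.

Fixpoint storeless (c : cmd) : bool :=
  match c with
  | Asg _ _ => true
  | Sto _ _ => false
  | Sq c1 c2 => storeless c1 && storeless c2
  | For _ c => storeless c
  end.

Lemma reg_den c s r : r \notin writes c -> reg (den c s) r = reg s r.
Proof.
elim: c s => [x e|a e|c1 IH1 c2 IH2|e c IH] s //=.
- by rewrite inE => ?; rewrite upd_neq.
- by rewrite mem_cat negb_or => /andP[h1 h2]; rewrite IH2 ?IH1.
- by move=> h; elim: (eval s e) => //= n <-; rewrite IH.
Qed.

Lemma mem_den c s : storeless c -> mem (den c s) = mem s.
Proof.
elim: c s => [x e|a e|c1 IH1 c2 IH2|e c IH] s //=.
- by move=> /andP[h1 h2]; rewrite IH2 ?IH1.
- by move=> h; elim: (eval s e) => //= n <-; rewrite IH.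
Qed.

(** * The search tree *)

Definition item := (nat * nat * nat)%type.

Definition end1 (x : item) : nat := x.1.1.
Definition end2 (x : item) : nat := x.1.2.
Definition time (x : item) : nat := x.2.

Definition at_vertex (v : nat) (x : item) : bool :=
  (v == end1 x) || (v == end2 x).

Definition share (x y : item) : bool :=
  at_vertex (end1 x) y || at_vertex (end2 x) y.

(** The two inequalities say that the times differ by less than [D]. *)
Definition conf (D : nat) (x y : item) : bool :=
  [&& time x < time y + D, time y < time x + D & share x y].

Definition indep (D : nat) (M : seq item) : Prop :=
  uniq M /\ {in M &, forall x y, x != y -> ~~ conf D x y}.

(* [u = 0] stands for no condition, [u = v.+1] for incidence with [v]. *)
Definition admissible (D : nat) (S : seq item) (u : nat) (x : item) : bool :=
  ~~ has (conf D x) S && ((u == 0) || at_vertex u.-1 x).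

Definition better (D : nat) (S : seq item) (u : nat) (b : option item)
    (x : item) : option item :=
  if admissible D S u x && (if b is Some y then time x < time y else true)
  then Some x else b.

Definition earliest (D : nat) (TE S : seq item) (u : nat) : option item :=
  foldl (better D S u) None TE.

Definition get (b : option item) : item := odflt (0, 0, 0) b.

(* Records that the neighbour of [u.-1] on the item [x] was tried: it conflicts
   with the time edges at that neighbour during the window around [time x]. *)
Definition tried (u : nat) (x : item) : item :=
  (end1 x + end2 x - u.-1, end1 x + end2 x - u.-1, time x).

(** If nothing is admissible, the record of a default item is pushed; it can only forbid more items,
    so soundness is unaffected. *)
Definition try_next (D : nat) (TE : seq item) (u : nat)
    (p : seq item * option item) : seq item * option item :=
  let b := earliest D TE p.1 u in (rcons p.1 (tried u (get b)), b).

(** Branching happens at an end point of the earliest free item. The item found in round [d.+1] is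
    the candidate with index [d], and the records pushed meanwhile are dropped. *)
Definition candidate (D : nat) (TE C : seq item) (d : nat) : option item :=
  let u := (end1 (get (earliest D TE C 0))).+1 in
  (iter d.+1 (try_next D TE u) (C, None)).2.

(* The state is the rest of the guess, the chosen items, and whether all
   choices were possible. *)
Definition extend (D : nat) (TE : seq item) (B : nat)
    (p : nat * seq item * bool) : nat * seq item * bool :=
  let: (g, C, ok) := p in
  let b := candidate D TE C (g %% B) in
  (g %/ B, rcons C (get b), ok && b).

Definition attempt (D : nat) (TE : seq item) (B k g : nat) : bool :=
  (iter k (extend D TE B) (g, [::], true)).2.

(** * The conflict relation *)

Section Conflicts.
Variables (D : nat).

Lemma shareC x y : share x y = share y x.
Proof.
by rewrite /share /at_vertex; do ![case: eqP => //] => *; exfalso; congruence.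
Qed.

Lemma confC x y : conf D x y = conf D y x.
Proof. by rewrite /conf shareC andbCA. Qed.

Lemma confxx x : 0 < D -> conf D x x.
Proof. by rewrite /conf /share /at_vertex eqxx /=; lia. Qed.

Lemma shareP x y :
  reflect (exists2 v, at_vertex v x & at_vertex v y) (share x y).
Proof.
apply: (iffP idP) => [/orP[] h|[v /orP[] /eqP -> h]].
- by exists (end1 x); rewrite // /at_vertex eqxx.
- by exists (end2 x); rewrite // /at_vertex eqxx orbT.
- by rewrite /share h.
- by rewrite /share h orbT.
Qed.

Lemma at_share v x y : at_vertex v x -> at_vertex v y -> share x y.
Proof. by move=> vx vy; apply/shareP; exists v. Qed.

End Conflicts.

(* [lia] would case split on the other boolean hypotheses. *)
Ltac leq_lia :=
  repeat match goal with H : is_true ?P |- _ =>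
    lazymatch P with leq _ _ => fail | _ => clear H end end; lia.

(** * Soundness and completeness of the search tree *)

Section Search.
Variables (D : nat) (TE : seq item).
Hypothesis D_gt0 : 0 < D.
Hypothesis TE_loopless : forall x, x \in TE -> end1 x != end2 x.

Lemma earliest_spec S u :
  if earliest D TE S u is Some x
  then [/\ x \in TE, admissible D S u x &
        forall y, y \in TE -> admissible D S u y -> time x <= time y]
  else forall y, y \in TE -> ~~ admissible D S u y.
Proof.
rewrite /earliest; elim/last_ind: TE => [|l x IH] //.
rewrite foldl_rcons; move: IH; case: (foldl _ _ _) => [z [zl az zmin]|nol].
  rewrite /better; case: ifP => [/andP[ax xz]|nx].
    split; rewrite ?mem_rcons ?mem_head //.
    move=> y; rewrite mem_rcons inE => /orP[/eqP -> //|yl ay].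
    by rewrite (leq_trans (ltnW xz)) // zmin.
  split; rewrite ?mem_rcons ?inE ?zl ?orbT //.
  move=> y; rewrite mem_rcons inE => /orP[/eqP -> ax|]; last exact: zmin.
  by move: nx; rewrite ax /= ltnNge => /negbFE.
rewrite /better andbT; case: ifP => [ax|nx].
  split; rewrite ?mem_rcons ?mem_head //.
  move=> y; rewrite mem_rcons inE => /orP[/eqP -> //|yl ay].
  by move: (nol y yl); rewrite ay.
by move=> y; rewrite mem_rcons inE => /orP[/eqP ->|/nol //]; rewrite nx.
Qed.

Lemma earliest_Some S u y : y \in TE -> admissible D S u y ->
  exists x, [/\ earliest D TE S u = Some x, x \in TE, admissible D S u x &
    time x <= time y].
Proof.
move=> yT ay; have := earliest_spec S u.
case: (earliest _ _ _ _) => [x [xT ax xmin]|/(_ y yT)]; last by rewrite ay.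
by exists x; split=> //; apply: xmin.
Qed.

Lemma try_next_prefix u n S b :
  exists E, (iter n (try_next D TE u) (S, b)).1 = S ++ E.
Proof.
elim: n => [|n [E /= ->]]; first by exists [::]; rewrite cats0.
by eexists; rewrite -cats1 -catA.
Qed.

(** The records only extend the list of items to be avoided, so whatever is admissible with them is
    free of conflicts with [C]. *)
Lemma candidate_sound C d x : candidate D TE C d = Some x ->
  x \in TE /\ ~~ has (conf D x) C.
Proof.
rewrite /candidate /=; set u := _.+1.
have [E ->] := try_next_prefix u d C None => e.
have := earliest_spec (C ++ E) u; rewrite e => -[xT /andP[h _] _].
by split=> //; apply: contra h; rewrite has_cat => ->.
Qed.

Lemma other_end u x : end1 x != end2 x -> at_vertex u x ->
  at_vertex (end1 x + end2 x - u) x /\ end1 x + end2 x - u != u.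
Proof.
case: x => [[a b] t]; rewrite /at_vertex /= => ne /orP[] /eqP ->; lia.
Qed.

Lemma at_vertexE u v x : at_vertex u x -> at_vertex v x ->
  v = u \/ v = end1 x + end2 x - u.
Proof.
case: x => [[a b] t]; rewrite /at_vertex /= => /orP[] /eqP -> /orP[] /eqP ->;
  lia.
Qed.

(* Each tried neighbour that does not work is covered by [M], hence there are
   at most [2 * size M] of them. *)
Lemma try_next_complete C M u y t0 W n b0 :
  (forall x, x \in TE -> ~~ has (conf D x) C -> t0 <= time x) ->
  y \in TE -> ~~ has (conf D y) C -> at_vertex u y -> time y < t0 + D ->
  (forall z, z \in M -> t0 <= time z /\ ~~ conf D z y) ->
  uniq (map end1 W) ->
  (forall p, p \in W -> [/\ end1 p = end2 p, end1 p != u, t0 <= time p,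
     time p <= time y &
     exists2 z, z \in M & at_vertex (end1 p) z && (time z < time p + D)]) ->
  2 * size M < size W + n ->
  exists d x, [/\ d < n,
    (iter d.+1 (try_next D TE u.+1) (C ++ W, b0)).2 = Some x,
    x \in TE, ~~ has (conf D x) C & forall z, z \in M -> ~~ conf D x z].
Proof.
move=> minC yT yC uy yt0 HM; elim: n W b0 => [|n IH] W b0 uW HW.
  (* No tries are left: the distinct vertices recorded in [W] all occur among the [2 * size M] end
     points of [M], which contradicts the size hypothesis. *)
  rewrite addn0 ltnNge => /negP[].
  have -> : 2 * size M = size (flatten [seq [:: end1 z; end2 z] | z <- M]).
    by elim: (M) => //= z l <-; leq_lia.
  rewrite -[size W](size_map end1); apply: uniq_leq_size => // w.
  case/mapP=> p pW ->; have [_ _ _ _ [z zM /andP[az _]]] := HW p pW.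
  apply/flatten_mapP; exists z => //; rewrite !inE; exact: az.
move=> sz.
(* A record blocking [y] would sit at the other end point of [y], and its witness in [M] would then
   conflict with [y]. *)
have ay : admissible D (C ++ W) u.+1 y.
  rewrite /admissible /= uy andbT has_cat negb_or yC /= -all_predC.
  apply/allP => p pW; apply/negP => /and3P[/= h1 h2 h3].
  have [pp pu t0p py [z zM /andP[az zt]]] := HW p pW.
  have [t0z /negP[]] := HM z zM.
  apply/and3P; split; [leq_lia | leq_lia |].
  apply: at_share az _; move/shareP: h3 => [v vy].
  by rewrite /at_vertex -pp orbb => /eqP <-.
have [x [ex xT ax xy]] := earliest_Some yT ay.
case/andP: (ax); rewrite /= has_cat negb_or => /andP[xC xW] ux.
have t0x := minC x xT xC.
case: (boolP (has (conf D x) M)) => [/hasP[z zM cxz]|noM]; last first.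
  exists 0, x; split=> //=.
  by move=> z zM; apply: contra noM => h; apply/hasP; exists z.
have [t0z nzy] := HM z zM.
case/and3P: cxz => xz zx /shareP[v vx vz].
have [wx wu] := other_end (TE_loopless xT) ux.
(* If [x] and [z] met at [u], then [z] would conflict with [y], because [t0 <= time z < time x + D]
   and [time x <= time y < t0 + D]. *)
have vw : v = end1 x + end2 x - u.
  case: (at_vertexE ux vx) => // e; case/negP: nzy; rewrite e in vz.
  by apply/and3P; split; [leq_lia | leq_lia | apply: at_share vz uy].
have stepE : try_next D TE u.+1 (C ++ W, b0)
   = (C ++ rcons W (v, v, time x), Some x).
  by rewrite /try_next /= ex -rcons_cat /tried /= -vw.
have [||| d [x' [dn e' x'T x'C x'M]]] := IH (rcons W (v, v, time x)) (Some x).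
(* The time of an earlier record at [v] would lie between [t0] and [time y], as does that of [x], so
   the record would have blocked [x]. *)
- rewrite map_rcons rcons_uniq uW andbT; apply/negP => /mapP[p pW /= vp].
  case/negP: xW; apply/hasP; exists p => //.
  have [pp pu t0p py _] := HW p pW.
  apply/and3P; split=> /=; [leq_lia | leq_lia |].
  by apply/shareP; exists v; rewrite // /at_vertex /= -vp eqxx.
- move=> p; rewrite mem_rcons inE => /orP[/eqP -> /=|/HW //].
  by split=> //; [rewrite vw | exists z => //; rewrite vz zx].
- by rewrite size_rcons; leq_lia.
by exists d.+1, x'; rewrite iterSr stepE.
Qed.

Lemma indep_rem M y : indep D M -> indep D (rem y M).
Proof.
case=> uM HM; split; first exact: rem_uniq.
by move=> x z /mem_rem xM /mem_rem zM; apply: HM.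
Qed.

Lemma indep_rem_conf M y z : indep D M -> y \in M -> z \in rem y M ->
  ~~ conf D z y.
Proof.
case=> uM HM yM; rewrite mem_rem_uniq // !inE => /andP[zy zM].
exact: HM.
Qed.

(* Replacing a suitable element of [M] by a candidate: the one that meets [u]
   within the window after [t0] if there is one, and otherwise the only one
   that conflicts with the first candidate. *)
Lemma candidate_complete C M B :
  indep D M -> (forall x, x \in M -> x \in TE /\ ~~ has (conf D x) C) ->
  0 < size M -> 2 * size M <= B ->
  exists d x y, [/\ d < B, candidate D TE C d = Some x, y \in M &
    forall z, z \in rem y M -> ~~ conf D x z].
Proof.
move=> iM HM; case E: M => [//|m0 M'] _; rewrite -E => szB.
have m0M : m0 \in M by rewrite E mem_head.
have [m0T m0C] := HM m0 m0M.
have Madm y : y \in M -> admissible D C 0 y.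
  by move=> /HM[_ yC]; rewrite /admissible yC.
have [x0 [ex0 x0T ax0 _]] := earliest_Some m0T (Madm m0 m0M).
have min0 x : x \in TE -> ~~ has (conf D x) C -> time x0 <= time x.
  move=> xT xC; have := earliest_spec C 0; rewrite ex0 => -[_ _]; apply=> //.
  by rewrite /admissible xC.
have MT z : z \in M -> time x0 <= time z by move=> /HM[zT zC]; apply: min0.
rewrite /candidate ex0 [get _]/=; set u := end1 x0.
(* If some [y] in [M] meets [u] before [time x0 + D], it is the one given up; the rest is smaller by
   one, so [B] tries suffice. *)
case: (boolP (has (fun y => at_vertex u y && (time y < time x0 + D)) M)).
  case/hasP=> y yM /andP[uy yt]; have [yT yC] := HM y yM.
  have szM : size (rem y M) = (size M).-1 by rewrite size_rem.
  have [||||d [x [dB ex _ _ Hx]]] :=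
    @try_next_complete C (rem y M) u y (time x0) [::] B None min0 yT yC uy yt.
  - move=> z zM; split; first exact: MT (mem_rem zM).
    exact: indep_rem_conf iM yM zM.
  - by [].
  - by move=> p.
  - have : 0 < size M by rewrite E.
    by rewrite szM /=; lia.
  by exists d, x, y; split=> //; move: ex; rewrite cats0.
move=> noM.
have x0C : ~~ has (conf D x0) C by case/andP: ax0.
have ux0 : at_vertex u x0 by rewrite /at_vertex eqxx.
have ax0u : admissible D C u.+1 x0 by rewrite /admissible x0C.
have [x [ex xT /andP[xC /= ux] xt]] := earliest_Some x0T ax0u.
have x0x := min0 x xT xC.
have B0 : 0 < B by apply: leq_trans szB; rewrite E /=; leq_lia.
(* As no element of [M] meets [u] in the window, a conflict with [x] must be at its other end point.
   The time bound uses [time x <= time x0], which holds as [x0] is admissible at [u] itself. *)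
have atw z : z \in M -> conf D x z ->
    at_vertex (end1 x + end2 x - u) z /\ time z < time x0 + D.
  move=> zM /and3P[h1 h2 /shareP[v vx vz]].
  have zt : time z < time x0 + D by leq_lia.
  split=> //; case: (at_vertexE ux vx) => [e|<- //].
  by case/hasP: noM; exists z => //; rewrite -e vz.
(* Two elements conflicting with [x] would share that end point within one window and conflict with
   each other. If there is none, any element may be given up. *)
have [y yM Hy] : exists2 y, y \in M &
    forall z, z \in M -> conf D x z -> z = y.
  case: (boolP (has (conf D x) M)) => [/hasP[y yM cy]|no]; last first.
    exists m0 => // z zM cz; case/hasP: no; by exists z.
  exists y => // z zM cz; apply/eqP; apply/idPn => ne.
  have [wz zt] := atw z zM cz; have [wy yt] := atw y yM cy.
  case/negP: (iM.2 z y zM yM ne); have := MT z zM; have := MT y yM.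
  by move=> h1 h2; apply/and3P; split;
    [leq_lia | leq_lia | apply: at_share wz wy].
exists 0, x, y; split=> //.
move=> z zM; apply/negP => cz.
have := Hy z (mem_rem zM) cz => e.
by move: zM; rewrite e mem_rem_uniq ?inE ?eqxx //; case: iM.
Qed.

(** A failed choice makes the flag false for good, so a true flag certifies that no default item was
    pushed. *)
Lemma iter_extend_sound B k g C : indep D C -> {subset C <= TE} ->
  let p := iter k (extend D TE B) (g, C, true) in
  p.2 -> [/\ indep D p.1.2, {subset p.1.2 <= TE} & size p.1.2 = k + size C].
Proof.
move=> iC sC; elim: k => [|k IH] //=.
case: (iter _ _ _) IH => [[g' C'] ok] /= IH.
case e: (candidate _ _ _ _) => [x|]; last by rewrite andbF.
rewrite andbT => /IH[[uC' HC'] sC' szC'].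
have [xT xC'] := candidate_sound e.
have nx z : z \in C' -> ~~ conf D x z.
  by move=> zC; apply: contra xC' => h; apply/hasP; exists z.
split.
- split.
    (* The new item is no repetition, since for positive [D] an item conflicts with itself. *)
    rewrite rcons_uniq uC' andbT; apply/negP => /nx.
    by rewrite confxx.
  move=> y z; rewrite !mem_rcons !inE => /orP[/eqP->|yC] /orP[/eqP->|zC] ne.
  + by rewrite eqxx in ne.
  + exact: nx.
  + by rewrite confC nx.
  + exact: HC'.
- by move=> y; rewrite mem_rcons inE => /orP[/eqP->|/sC'].
- by rewrite size_rcons szC'.
Qed.

(** Here [M] is a completion of [C]. The exchange adds a candidate [x] to [C] and deletes one [y]
    from [M], which leaves a completion with one choice fewer. *)
Lemma iter_extend_complete B k C M :
  indep D M -> (forall x, x \in M -> x \in TE /\ ~~ has (conf D x) C) ->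
  size M = k -> 2 * k <= B ->
  exists2 g, g < B ^ k & (iter k (extend D TE B) (g, C, true)).2.
Proof.
elim: k C M => [|k IH] C M iM HM szM kB; first by exists 0.
have [||d [x [y [dB ex yM Hy]]]] := @candidate_complete C M B iM HM.
- by rewrite szM.
- by rewrite szM.
have [|||g gB Hg] := IH (rcons C x) (rem y M) (indep_rem y iM).
- move=> z zM; have [zT zC] := HM z (mem_rem zM); split=> //.
  by rewrite has_rcons negb_or zC andbT confC Hy.
- by rewrite size_rem // szM.
- by leq_lia.
(* The lowest digit in base [B] encodes the first choice. *)
exists (g * B + d); first by rewrite expnS; nia.
rewrite iterSr {2}/extend modnMDl modn_small //.
rewrite divnMDl ?(leq_ltn_trans _ dB) //.
by rewrite divn_small // addn0 ex.
Qed.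

Lemma attemptP B k : 2 * k <= B ->
  (exists2 g, g < B ^ k & attempt D TE B k g) <->
  (exists M, [/\ indep D M, {subset M <= TE} & size M = k]).
Proof.
move=> kB; split=> [[g _ /iter_extend_sound H]|[M [iM sM szM]]].
  have [||iM sM szM] := H; [by [] | by [] |].
  by eexists; split; [exact: iM | exact: sM | rewrite szM addn0].
by apply: (iter_extend_complete iM _ szM kB) => x /sM.
Qed.

End Search.

(** * Commands of the language *)

(** With truncated subtraction, [1 - e] is the negation of [e], and a double negation normalises any
    value to 0 or 1. *)
Definition ENot e := ESub (ECst 1) e.
Definition ELt a b := ENot (ENot (ESub b a)).
Definition EEq a b := ENot (EAdd (ESub a b) (ESub b a)).
Definition EAnd a b := ENot (EAdd (ENot a) (ENot b)).
Definition EOr a b := ENot (ENot (EAdd a b)).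

Lemma eval_lt s a b : eval s (ELt a b) = (eval s a < eval s b).
Proof. by rewrite /=; lia. Qed.
Lemma eval_eq s a b : eval s (EEq a b) = (eval s a == eval s b).
Proof. by rewrite /=; lia. Qed.
Lemma eval_and s a b : eval s (EAnd a b) = (0 < eval s a) && (0 < eval s b).
Proof. by rewrite /=; lia. Qed.
Lemma eval_or s a b : eval s (EOr a b) = (0 < eval s a) || (0 < eval s b).
Proof. by rewrite /=; lia. Qed.
Definition eval_bool := (eval_lt, eval_eq, eval_and, eval_or, lt0b).

(** * The program *)

(* After the input, from address [vL] on, there is a stack of [vNS] items ending
   at [vTop]; the first [vNC] of them, ending at [vCTop], are chosen time edges
   and the others exclude neighbours.  [vF] tells whether an earliest item
   ([vBA], [vBB], [vBT]) was found. *)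
Local Notation vAns := 0 (only parsing).
Local Notation vDelta := 1 (only parsing).
Local Notation vK := 2 (only parsing).
Local Notation vP := 3 (only parsing).
Local Notation vA := 4 (only parsing).
Local Notation vB := 5 (only parsing).
Local Notation vT := 6 (only parsing).
Local Notation vQ := 7 (only parsing).
Local Notation vFree := 8 (only parsing).
Local Notation vU := 9 (only parsing).
Local Notation vF := 10 (only parsing).
Local Notation vBA := 11 (only parsing).
Local Notation vBB := 12 (only parsing).
Local Notation vBT := 13 (only parsing).
Local Notation vL := 14 (only parsing).
Local Notation vNS := 15 (only parsing).
Local Notation vTop := 16 (only parsing).
Local Notation vNC := 17 (only parsing).
Local Notation vCTop := 18 (only parsing).
Local Notation vBase := 19 (only parsing).
Local Notation vPow := 20 (only parsing).
Local Notation vAcc := 21 (only parsing).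
Local Notation vGuess := 22 (only parsing).
Local Notation vCur := 23 (only parsing).
Local Notation vQuo := 24 (only parsing).
Local Notation vDig := 25 (only parsing).
Local Notation vOk := 26 (only parsing).
Local Notation vCnt := 27 (only parsing).

Local Notation "c1 ;; c2" := (Sq c1 c2) (at level 60, right associativity).
Local Notation "x <~ e" := (Asg x e) (at level 55).
Local Notation "$ x" := (EVar x) (at level 2, format "$ x").
Local Notation "# c" := (ECst c) (at level 2, format "# c").

Definition Incr x c := x <~ EAdd $x #c.

Definition blockedE : exp :=
  EAnd (ELt $vT (EAdd (ELoad (EAdd $vQ #2)) $vDelta))
 (EAnd (ELt (ELoad (EAdd $vQ #2)) (EAdd $vT $vDelta))
   (EOr (EOr (EEq $vA (ELoad $vQ)) (EEq $vA (ELoad (EAdd $vQ #1))))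
        (EOr (EEq $vB (ELoad $vQ)) (EEq $vB (ELoad (EAdd $vQ #1)))))).

(** Truncated subtraction keeps [vFree] at 0 once a conflict was met. *)
Definition check : cmd :=
  vFree <~ #1 ;; vQ <~ $vL ;;
  For $vNS (vFree <~ ESub $vFree blockedE ;; Incr vQ 3).

Definition betterE : exp :=
  EAnd $vFree
   (EAnd (EOr (EEq $vU #0)
              (EOr (EEq $vU (EAdd $vA #1)) (EEq $vU (EAdd $vB #1))))
         (EOr (EEq $vF #0) (ELt $vT $vBT))).

(** A loop bounded by 0 or 1 serves as a conditional. *)
Definition visit : cmd :=
  check ;;
  For betterE (vF <~ #1 ;; vBA <~ $vA ;; vBB <~ $vB ;; vBT <~ $vT).

(** Cells 0 to 3 are the header, with the number of edges in cell 1. After the cursor has skipped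
    the three leading cells of an edge, its number of labels is at [vP - 1]. *)
Definition scan (body : cmd) : cmd :=
  vP <~ #4 ;;
  For (ELoad #1) (
    vA <~ ELoad $vP ;; vB <~ ELoad (EAdd $vP #1) ;; Incr vP 3 ;;
    For (ELoad (ESub $vP #1)) (vT <~ ELoad $vP ;; Incr vP 1 ;; body)).

Definition find_earliest : cmd :=
  vF <~ #0 ;; vBA <~ #0 ;; vBB <~ #0 ;; vBT <~ #0 ;; scan visit.

Definition try_cmd : cmd :=
  find_earliest ;;
  Sto $vTop (ESub (EAdd $vBA $vBB) (ESub $vU #1)) ;;
  Sto (EAdd $vTop #1) (ESub (EAdd $vBA $vBB) (ESub $vU #1)) ;;
  Sto (EAdd $vTop #2) $vBT ;;
  Incr vTop 3 ;; Incr vNS 1.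

(* Linear in the guess, which is less than (2k)^k. *)
Definition divmod_cmd : cmd :=
  vQuo <~ #0 ;; vDig <~ #0 ;;
  For $vCur (Incr vDig 1 ;;
    For (EEq $vDig $vBase) (vDig <~ #0 ;; Incr vQuo 1)) ;;
  vCur <~ $vQuo.

(** The records go on top of the chosen items; the last candidate survives in the registers and is
    then stored where the records began, which discards them. *)
Definition extend_cmd : cmd :=
  divmod_cmd ;;
  vNS <~ $vNC ;; vTop <~ $vCTop ;; vU <~ #0 ;;
  find_earliest ;;
  vU <~ EAdd $vBA #1 ;;
  For (EAdd $vDig #1) try_cmd ;;
  Sto $vCTop $vBA ;; Sto (EAdd $vCTop #1) $vBB ;; Sto (EAdd $vCTop #2) $vBT ;;
  Incr vCTop 3 ;; Incr vNC 1 ;; vOk <~ EAnd $vOk $vF.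

(** Multiplication by [vBase] is repeated addition. *)
Definition power_cmd : cmd :=
  vBase <~ EAdd $vK $vK ;; vPow <~ #1 ;;
  For $vK (vAcc <~ #0 ;; For $vBase (vAcc <~ EAdd $vAcc $vPow) ;;
           vPow <~ $vAcc).

(** [vAns] counts the successful guesses. *)
Definition attempt_cmd : cmd :=
  vCur <~ $vGuess ;; vOk <~ #1 ;; vNC <~ #0 ;; vCTop <~ $vL ;;
  For $vK extend_cmd ;;
  vAns <~ EAdd $vAns $vOk ;; Incr vGuess 1.

Definition search_cmd : cmd :=
  power_cmd ;; vGuess <~ #0 ;; For $vPow attempt_cmd.

Definition main_cmd : cmd :=
  vDelta <~ ELoad #2 ;; vK <~ ELoad #3 ;; vCnt <~ #0 ;; scan (Incr vCnt 1) ;;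
  vL <~ $vP ;;
  vAns <~ EAnd (EEq $vDelta #0) (ELt $vK (EAdd $vCnt #1)) ;;
  For (ELt #0 $vDelta) search_cmd.

Definition num_vars := 28.

Lemma main_wf : wf_cmd num_vars main_cmd.
Proof. by []. Qed.

(** * Memory contents *)

Definition mem_at (m : nat -> nat) (p : nat) (l : seq nat) : Prop :=
  forall i, i < size l -> m (p + i) = nth 0 l i.

Lemma mem_at_cons m p v l : mem_at m p (v :: l) <-> m p = v /\ mem_at m p.+1 l.
Proof.
split=> [H|[H1 H2] [|i] /= il]; [|by rewrite addn0|by rewrite -addSnnS H2].
split; first by have := H 0 isT; rewrite addn0.
by move=> i il; rewrite addSnnS (H i.+1).
Qed.

Lemma mem_at_cat m p l1 l2 :
  mem_at m p (l1 ++ l2) <-> mem_at m p l1 /\ mem_at m (p + size l1) l2.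
Proof.
elim: l1 p => [|v l IH] p /=; first by rewrite addn0; split=> [|[]].
rewrite !mem_at_cons IH addSnnS; tauto.
Qed.

Lemma mem_at_upd m p l a v : p + size l <= a -> mem_at m p l ->
  mem_at (upd m a v) p l.
Proof. by move=> pa H i il; rewrite upd_neq ?H //; lia. Qed.

Lemma mem_at_rcons m p l a v : a = p + size l -> mem_at m p l ->
  mem_at (upd m a v) p (rcons l v).
Proof.
move=> -> H; rewrite -cats1; apply/mem_at_cat; split; first exact: mem_at_upd.
by apply/mem_at_cons; rewrite upd_same.
Qed.

Definition input_edge := (nat * nat * seq nat)%type.

Definition edge_cells (e : input_edge) : seq nat :=
  [:: e.1.1, e.1.2, size e.2 & e.2].

Definition edge_items (e : input_edge) : seq item :=
  [seq (e.1.1, e.1.2, t) | t <- e.2].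

Definition cells (es : seq input_edge) := flatten [seq edge_cells e | e <- es].
Definition items (es : seq input_edge) := flatten [seq edge_items e | e <- es].

Definition item_cells (S : seq item) : seq nat :=
  flatten [seq [:: end1 x; end2 x; time x] | x <- S].

Lemma size_item_cells S : size (item_cells S) = 3 * size S.
Proof. by elim: S => //= x S IH; rewrite -/(item_cells S) IH; lia. Qed.

Lemma item_cells_rcons S x :
  item_cells (rcons S x) =
    rcons (rcons (rcons (item_cells S) (end1 x)) (end2 x)) (time x).
Proof.
by rewrite /item_cells map_rcons flatten_rcons -!cats1 -!catA.
Qed.

Lemma item_cells_cat S1 S2 :
  item_cells (S1 ++ S2) = item_cells S1 ++ item_cells S2.
Proof. by rewrite /item_cells map_cat flatten_cat. Qed.

(** * Scanning *)

Definition cur_item (s : ram_state) : item := (reg s vA, reg s vB, reg s vT).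

Lemma eval_blockedE s x :
  mem_at (mem s) (reg s vQ) [:: end1 x; end2 x; time x] ->
  eval s blockedE = conf (reg s vDelta) (cur_item s) x.
Proof.
move=> /mem_at_cons[h1 /mem_at_cons[h2 /mem_at_cons[h3 _]]].
by rewrite /blockedE !eval_bool /= addn1 addn2 h1 h2 h3.
Qed.

Lemma checkP S s : mem_at (mem s) (reg s vL) (item_cells S) ->
  reg s vNS = size S ->
  cost check s <= 200 * (size S).+1 /\
  reg (den check s) vFree = ~~ has (conf (reg s vDelta) (cur_item s)) S.
Proof.
move=> mS nS; pose s1 := den (vFree <~ #1 ;; vQ <~ $vL) s.
pose I (l r : seq item) s' := [/\ mem_at (mem s') (reg s' vQ) (item_cells r),
  reg s' vFree = ~~ has (conf (reg s vDelta) (cur_item s)) l,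
  cur_item s' = cur_item s & reg s' vDelta = reg s vDelta].
have [||l x r s' [mr fr ic dl]|] := @for_seqP item
   (vFree <~ ESub $vFree blockedE ;; Incr vQ 3) I (fun=> 150) $vNS S s1.
- by [].
- by [].
- have mx : mem_at (mem s') (reg s' vQ) [:: end1 x; end2 x; time x].
    by move: mr; rewrite -[x :: r]cat1s item_cells_cat => /mem_at_cat[].
  have vx := eval_blockedE mx; split; first by [].
  split=> //=.
  + move: mr; rewrite -[x :: r]cat1s item_cells_cat => /mem_at_cat[_].
    by rewrite /= upd_same.
  + have -> : upd (upd (reg s') vFree (reg s' vFree - eval s' blockedE)) vQ
      (upd (reg s') vFree (reg s' vFree - eval s' blockedE) vQ + 3) vFree
        = reg s' vFree - eval s' blockedE by [].
    rewrite vx ic dl fr has_rcons; by case: (conf _ _ _); case: has.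
- move=> h1 [_ h2 _ _]; split=> //.
  have -> : cost check s = 4 + cost (For $vNS
     (vFree <~ ESub $vFree blockedE ;; Incr vQ 3)) s1 by [].
  have e : sumn [seq 150 + 3 | _ <- S] = 153 * size S.
    by elim: (S) => //= _ l ->; lia.
  by move: h1; rewrite e [ecost _]/=; lia.
Qed.

Lemma for_bool e c s (b : bool) : eval s e = b ->
  cost (For e c) s <= ecost e + cost c s + 4 /\
  den (For e c) s = if b then den c s else s.
Proof. by rewrite /= => ->; case: b => /=; split=> //; lia. Qed.

Definition holds (s : ram_state) (b : option item) : Prop :=
  reg s vF = isSome b /\ (reg s vBA, reg s vBB, reg s vBT) = get b.

Lemma visitP S s b : mem_at (mem s) (reg s vL) (item_cells S) ->
  reg s vNS = size S -> holds s b ->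
  cost visit s <= 500 * (size S).+1 /\
  holds (den visit s)
    (better (reg s vDelta) S (reg s vU) b (cur_item s)).
Proof.
move=> mS nS [bF bB]; have [c1 fr] := checkP mS nS.
set s1 := den check s in fr *.
have E : eval s1 betterE =
  admissible (reg s vDelta) S (reg s vU) (cur_item s) &&
  (if b is Some y then time (cur_item s) < time y else true).
  rewrite /betterE !eval_bool /= fr !reg_den // bF /admissible /at_vertex.
  rewrite lt0b -andbA; congr (nat_of_bool (_ && (_ && _))).
    by case: (reg s vU) => //= u; rewrite !addn1 !eqSS.
  by case: b bF bB => [y|] //= _ <-.
pose record := vF <~ #1 ;; vBA <~ $vA ;; vBB <~ $vB ;; vBT <~ $vT.
have [c2 d2] := @for_bool betterE record s1 _ E.
split.
  rewrite [cost _ _]/(cost check s + cost (For betterE record) s1).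
  move: c2; rewrite [ecost _]/= [cost record _]/=; lia.
rewrite (d2 : den visit s = _) /better; case: ifP => _.
  by split=> //; rewrite /= !updE /= /s1 !reg_den.
by rewrite /holds !reg_den.
Qed.

Lemma cells_cons e es : cells (e :: es) = edge_cells e ++ cells es.
Proof. by []. Qed.

Lemma items_rcons es e : items (rcons es e) = items es ++ edge_items e.
Proof. by rewrite /items map_rcons flatten_rcons. Qed.

Lemma cells_rcons es e : cells (rcons es e) = cells es ++ edge_cells e.
Proof. by rewrite /cells map_rcons flatten_rcons. Qed.

Lemma size_items es : size (items es) = sumn [seq size e.2 | e <- es].
Proof.
rewrite /items size_flatten /shape -map_comp; congr sumn.
by apply: eq_map => e /=; rewrite size_map.
Qed.

Section Scan.
Variables (body : cmd) (b : nat) (es : seq input_edge).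
Variable (I : seq item -> ram_state -> Prop).
Hypothesis body_storeless : storeless body.
Hypothesis body_P : vP \notin writes body.
Hypothesis body_A : vA \notin writes body.
Hypothesis body_B : vB \notin writes body.
Hypothesis I_stable : forall l s s', mem s = mem s' ->
  (forall r, r \notin [:: vP; vA; vB; vT] -> reg s r = reg s' r) ->
  I l s -> I l s'.
Hypothesis I_step : forall l s, I l s ->
  cost body s <= b /\ I (rcons l (cur_item s)) (den body s).

(** Charging the inner loop per label makes the labels of all edges contribute [size (items es)] in
    total. The final cursor marks the first cell after the input, where the stack will start. *)
Lemma scanP s : mem s 1 = size es -> mem_at (mem s) 4 (cells es) -> I [::] s ->
  [/\ cost (scan body) s <= (b + 60) * (size es + size (items es)).+1,
      I (items es) (den (scan body) s) &
      reg (den (scan body) s) vP = 4 + size (cells es)].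
Proof.
move=> m1 m4 I0.
pose s1 := den (vP <~ #4) s.
pose inner := (vT <~ ELoad $vP ;; Incr vP 1 ;; body).
pose outer := (vA <~ ELoad $vP ;; vB <~ ELoad (EAdd $vP #1) ;; Incr vP 3 ;;
    For (ELoad (ESub $vP #1)) inner).
pose J (l r : seq input_edge) s' :=
  [/\ I (items l) s', mem_at (mem s') (reg s' vP) (cells r)
    & reg s' vP = 4 + size (cells l)].
have [||l e r s2 [I2 m2 p2]|h1 [h2 _ h3]] := @for_seqP _ outer J
    (fun e => 50 + size e.2 * (b + 12)) (ELoad #1) es s1.
- by rewrite /= m1.
- split=> //; apply: I_stable I0 => // r; rewrite !inE !negb_or.
  by case/and4P=> *; rewrite /s1 /= upd_neq.
- pose s3 := den (vA <~ ELoad $vP ;; vB <~ ELoad (EAdd $vP #1) ;; Incr vP 3) s2.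
  move: m2; rewrite cells_cons => /mem_at_cat[].
  case/mem_at_cons=> mA /mem_at_cons[mB /mem_at_cons[mL mT]] mr.
  (* Invariant of the inner loop: the labels [lt] of the current edge were visited, and [rt] starts
     at the cursor. *)
  pose K (lt rt : seq nat) s' :=
    [/\ I (items l ++ [seq (e.1.1, e.1.2, t) | t <- lt]) s',
      mem_at (mem s') (reg s' vP) rt, (reg s' vA, reg s' vB) = e.1,
      mem s' = mem s2 & reg s' vP = reg s2 vP + 3 + size lt].
  have [||lt t rt s4 [I4 m4' ab4 e4 p4]|k1 [k2 _ _ k5 k6]] :=
    @for_seqP _ inner K (fun=> b + 7) (ELoad (ESub $vP #1)) e.2 s3.
  + rewrite /s3 /= ?updE /= -mL. f_equal; lia.
  + split=> //=.
    * rewrite cats0; apply: I_stable I2 => // r'; rewrite !inE !negb_or.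
      by case/and4P=> *; rewrite /s3 /= !upd_neq.
    * by rewrite ?updE /= addn3.
    * by rewrite !updE /= addn1 mA mB; case: (e.1).
    * by rewrite !updE /= addn0.
  + pose s5 := den (vT <~ ELoad $vP ;; Incr vP 1) s4.
    case/mem_at_cons: m4' => mt mrt.
    have c5 : cur_item s5 = (e.1.1, e.1.2, t).
      by rewrite /cur_item /= -ab4 mt.
    have I5 : I (items l ++ [seq (e.1.1, e.1.2, t) | t <- lt]) s5.
      apply: I_stable I4 => // r'; rewrite !inE !negb_or.
      by case/and4P=> *; rewrite /s5 /= !upd_neq.
    have [ci Ii] := I_step I5.
    rewrite [cost inner s4]/(3 + (4 + cost body s5)).
    split; first lia.
    rewrite [den inner s4]/(den body s5); split.
    * by rewrite map_rcons -rcons_cat -c5.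
    * rewrite mem_den // reg_den // /s5 /= upd_same.
      by rewrite upd_neq // addn1.
    * by rewrite !reg_den.
    * by rewrite mem_den.
    * by rewrite reg_den // size_rcons /s5 /= !updE /= p4; lia.
  + rewrite [den outer s2]/(den (For (ELoad (ESub $vP #1)) inner) s3).
    split.
      have -> : cost outer s2 = 3 + (5 + (4 +
         cost (For (ELoad (ESub $vP #1)) inner) s3)) by [].
      have E : sumn [seq b + 7 + 3 | _ <- e.2] = (b + 10) * size e.2.
        by elim: (e.2) => [|? q /= ->]; rewrite ?muln0 //; lia.
      rewrite E [ecost _]/= in k1; nia.
    split; first by rewrite items_rcons.
      rewrite k5 k6; have -> // : reg s2 vP + 3 + size e.2 =
        reg s2 vP + size (edge_cells e) by rewrite /=; lia.
    by rewrite k6 p2 cells_rcons size_cat /edge_cells /=; lia.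
split.
- have -> : cost (scan body) s = 2 + cost (For (ELoad #1) outer) s1 by [].
  have E : sumn [seq 50 + size e.2 * (b + 12) + 3 | e <- es]
     = 53 * size es + (b + 12) * size (items es).
    rewrite size_items; elim: (es) => [|x l /= ->]; first by rewrite !muln0.
    set z := size x.2; set w := sumn _; rewrite mulnDr mulnS; lia.
  rewrite E [ecost _]/= in h1; nia.
- exact: h2.
- exact: h3.
Qed.

End Scan.

(** * Division of the guess and computation of the power *)

Lemma divmodP s : 0 < reg s vBase ->
  [/\ cost divmod_cmd s <= 40 * (reg s vCur).+1,
      reg (den divmod_cmd s) vDig = reg s vCur %% reg s vBase &
      reg (den divmod_cmd s) vCur = reg s vCur %/ reg s vBase].
Proof.
set B := reg s vBase; set g := reg s vCur => B0.
pose s1 := den (vQuo <~ #0 ;; vDig <~ #0) s.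
pose wrap := vDig <~ #0 ;; Incr vQuo 1.
pose body := Incr vDig 1 ;; For (EEq $vDig $vBase) wrap.
pose I i s' := [/\ reg s' vBase = B, reg s' vDig = i %% B
  & reg s' vQuo = i %/ B].
have [||i s2 _ [e1 e2 e3]|h1 [h2 h3 h4]] := @forP body I 30 g $vCur s1.
- by [].
- by split=> //; rewrite ?mod0n ?div0n.
- pose s3 := den (Incr vDig 1) s2.
  have E : eval s3 (EEq $vDig $vBase) = ((i %% B).+1 == B).
    by rewrite eval_eq /s3 /= !updE /= e1 e2 addn1.
  have [cw dw] := @for_bool _ wrap s3 _ E.
  split.
    rewrite [cost body s2]/(4 + cost (For (EEq $vDig $vBase) wrap) s3).
    by move: cw; rewrite [ecost _]/= [cost wrap _]/=; lia.
  rewrite /I (dw : den body s2 = _) modnS divnS //.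
  have dv : (B %| i.+1) = ((i %% B).+1 == B).
    rewrite /dvdn -addn1 -modnDml addn1.
    have := ltn_pmod i B0; rewrite leq_eqVlt => /orP[/eqP->|h].
      by rewrite modnn !eqxx.
    by rewrite modn_small // (ltn_eqF h).
  rewrite dv; case: eqP => eB; rewrite /= /s3 /= !updE /= ?e1 ?e2 ?e3 ?addn0.
    by split=> //; rewrite addn1.
  by split=> //; rewrite addn1.
- split.
  + rewrite [cost divmod_cmd s]/(2 + (2 + (cost (For $vCur body) s1 + 2))).
    by rewrite [ecost _]/= in h1; lia.
  + exact: h3.
  + exact: h4.
Qed.

Lemma den_Sq c1 c2 s : den (c1 ;; c2) s = den c2 (den c1 s).
Proof. by []. Qed.

Lemma powerP s :
  [/\ cost power_cmd s <= 30 * ((reg s vK).+1 * (2 * reg s vK).+1),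
      reg (den power_cmd s) vBase = 2 * reg s vK &
      reg (den power_cmd s) vPow = (2 * reg s vK) ^ reg s vK].
Proof.
set k := reg s vK.
pose s1 := den (vBase <~ EAdd $vK $vK ;; vPow <~ #1) s.
pose inner := vAcc <~ EAdd $vAcc $vPow.
pose outer := vAcc <~ #0 ;; For $vBase inner ;; vPow <~ $vAcc.
pose I i s' := reg s' vBase = 2 * k /\ reg s' vPow = (2 * k) ^ i.
have [||i s2 _ [e1 e2]|c1 [h1 h2]] :=
  @forP outer I (8 * (2 * k).+1) k $vK s1.
- by [].
- by split; rewrite /s1 /= !updE //= addnn mul2n.
- pose s3 := den (vAcc <~ #0) s2.
  pose J i s' := [/\ reg s' vAcc = i * reg s2 vPow,
     reg s' vPow = reg s2 vPow & reg s' vBase = reg s2 vBase].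
  have [||j s4 _ [j1 j2 j3]|c3 [j1 j2 j3]] :=
    @forP inner J 4 (2 * k) $vBase s3.
  + by rewrite -e1.
  + by split; rewrite /s3 /= !updE /= ?mul0n.
  + by split=> //; split; rewrite /= !updE //= j1 j2 mulSn addnC.
  + have -> : cost outer s2 = 2 + (cost (For $vBase inner) s3 + 2) by [].
    split; first by rewrite [ecost _]/= in c3; lia.
    rewrite /outer !den_Sq -/s3; split; rewrite /= updE /=.
      by rewrite j3.
    by rewrite j1 e2 expnS.
- have -> : cost power_cmd s = 4 + (2 + cost (For $vK outer) s1) by [].
  split; last 2 first.
  + exact: h1.
  + exact: h2.
  rewrite [ecost _]/= in c1; nia.
Qed.

(** * Correctness and cost of a single attempt *)

Section SearchCommands.
Variables (es : seq input_edge) (D : nat).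
Let TE := items es.
Let X := (size es + size TE).+1.

Definition ready (S : seq item) (s : ram_state) : Prop :=
  [/\ mem s 1 = size es, mem_at (mem s) 4 (cells es ++ item_cells S),
      reg s vL = 4 + size (cells es), reg s vNS = size S & reg s vDelta = D].

Lemma find_earliestP S s : ready S s ->
  cost find_earliest s <= 700 * ((size S).+1 * X) /\
  holds (den find_earliest s) (earliest D TE S (reg s vU)).
Proof.
case=> m1 mS eL eN eD.
pose s1 := den (vF <~ #0 ;; vBA <~ #0 ;; vBB <~ #0 ;; vBT <~ #0) s.
pose I (l : seq item) s' :=
  [/\ mem s' = mem s, reg s' vL = reg s vL, reg s' vNS = reg s vNS,
      (reg s' vDelta, reg s' vU) = (reg s vDelta, reg s vU)
    & holds s' (foldl (better D S (reg s vU)) None l)].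
have [|||||||||h1 [_ _ _ _ h2] _] :=
  @scanP visit (500 * (size S).+1) es I _ _ _ _ _ _ s1.
- by [].
- by [].
- by [].
- by [].
- move=> l s2 s3 e23 r23 [i1 i2 i3 i4 [i5 i6]]; split; rewrite -?e23 -?r23 //.
  by split; rewrite -!r23 //.
- move=> l s2 [i1 i2 i3 [i4 i4'] i5].
  have [||c2 h2] := @visitP S s2 _ _ _ i5.
  + by rewrite i1 i2 eL; case/mem_at_cat: mS.
  + by rewrite i3.
  + split=> //; split; rewrite ?mem_den ?reg_den //; first by rewrite i4 i4'.
    by move: h2; rewrite foldl_rcons i4 i4' eD.
- by [].
- by case/mem_at_cat: mS.
- by [].
- split.
    rewrite [cost _ _]/(2 + (2 + (2 + (2 + cost (scan visit) s1)))).
    move: h1; rewrite -/TE -/X; set a := (size S).+1.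
    have : 0 < a by []. have : 0 < X by []. nia.
  exact: h2.
Qed.

Lemma ready_push S x s a : ready S s -> a = reg s vL + 3 * size S ->
  mem_at (upd (upd (upd (mem s) a (end1 x)) (a + 1) (end2 x)) (a + 2) (time x))
    4 (cells es ++ item_cells (rcons S x)).
Proof.
case=> _ mS eL _ _ ea; rewrite item_cells_rcons -!rcons_cat.
by do 3![apply: mem_at_rcons;
  first by rewrite ?size_rcons size_cat size_item_cells; lia].
Qed.

(** [try_next] ignores the second component of its argument, so [None] stands for any value. *)
Lemma tryP S s : ready S s -> reg s vTop = reg s vL + 3 * size S ->
  let p := try_next D TE (reg s vU) (S, None) in
  [/\ cost try_cmd s <= 700 * ((size S).+1 * X) + 60,
      ready p.1 (den try_cmd s), holds (den try_cmd s) p.2 &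
      reg (den try_cmd s) vTop = reg (den try_cmd s) vL + 3 * size p.1].
Proof.
move=> rS eT p; have [c1 [hF hB]] := find_earliestP rS.
set b := earliest _ _ _ _ in hF hB.
have [-> ->] : p.1 = rcons S (tried (reg s vU) (get b)) /\ p.2 = b by [].
pose s1 := den find_earliest s.
have rS1 : ready S s1.
  by case: rS => *; split; rewrite /s1 ?mem_den ?reg_den.
have eT1 : reg s1 vTop = reg s1 vL + 3 * size S by rewrite !reg_den.
have eU : reg s1 vU = reg s vU by rewrite reg_den.
have B1 : reg s1 vBA = end1 (get b) by rewrite -hB.
have B2 : reg s1 vBB = end2 (get b) by rewrite -hB.
have B3 : reg s1 vBT = time (get b) by rewrite -hB.
pose s2 := den (
  Sto $vTop (ESub (EAdd $vBA $vBB) (ESub $vU #1)) ;;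
  Sto (EAdd $vTop #1) (ESub (EAdd $vBA $vBB) (ESub $vU #1)) ;;
  Sto (EAdd $vTop #2) $vBT ;;
  Incr vTop 3 ;; Incr vNS 1) s1.
pose w := reg s1 vBA + reg s1 vBB - (reg s1 vU - 1).
have tE : tried (reg s vU) (get b) = (w, w, reg s1 vBT).
  by rewrite /tried /w B1 B2 B3 eU subn1.
have := @ready_push S (w, w, reg s1 vBT) s1 _ rS1 eT1 => mP.
rewrite -[den try_cmd s]/s2; case: (rS1) => m1 mS eL eN eD.
split.
- rewrite [cost try_cmd s]/(cost find_earliest s + 33); lia.
- split=> //.
  + rewrite /s2 /= !upd_neq ?m1 // eT1 eL; lia.
  + by rewrite tE; exact: mP.
  + by rewrite size_rcons /s2 /= !updE /= eN addn1.
- by split; [exact: hF | exact: hB].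
- by rewrite size_rcons /s2 /= !updE /= eT1; lia.
Qed.

(** Nothing is said about [vNS], [vTop] or the cells above the chosen items, so records left by
    earlier candidates are void. *)
Definition search_state (B : nat) (p : nat * seq item * bool) (s : ram_state) :
    Prop :=
  [/\ mem s 1 = size es /\ mem_at (mem s) 4 (cells es ++ item_cells p.1.2),
      reg s vL = 4 + size (cells es) /\ reg s vDelta = D,
      reg s vNC = size p.1.2 /\ reg s vCTop = reg s vL + 3 * size p.1.2,
      reg s vBase = B &
      reg s vCur = p.1.1 /\ reg s vOk = p.2].

Lemma extend_cmdP B g C ok s : 0 < B -> search_state B (g, C, ok) s ->
  cost extend_cmd s <= 40 * g + 2000 * ((size C + B) * (B * X)) /\
  search_state B (extend D TE B (g, C, ok)) (den extend_cmd s).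
Proof.
move=> B0 [[m1 mC] [eL eD] [eN eT] eB [eG eO]].
rewrite [(_, _).1.2]/= [(_, _).2]/= in mC eN eT eO.
rewrite [(_, _).1.1]/= in eG.
pose s1 := den divmod_cmd s.
pose s2 := den (vNS <~ $vNC ;; vTop <~ $vCTop ;; vU <~ #0) s1.
pose s3 := den find_earliest s2.
pose s4 := den (vU <~ EAdd $vBA #1) s3.
pose s5 := den (For (EAdd $vDig #1) try_cmd) s4.
pose s6 := den (Sto $vCTop $vBA ;; Sto (EAdd $vCTop #1) $vBB ;;
  Sto (EAdd $vCTop #2) $vBT ;; Incr vCTop 3 ;; Incr vNC 1 ;;
  vOk <~ EAnd $vOk $vF) s5.
have c6 : cost extend_cmd s = cost divmod_cmd s + (2 + (2 + (2 +
  (cost find_earliest s2 + (4 +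
    (cost (For (EAdd $vDig #1) try_cmd) s4 + 31)))))).
  by [].
have -> : den extend_cmd s = s6.
  by rewrite /s6 /s5 /s4 /s3 /s2 /s1 /extend_cmd !den_Sq.
have fr1 r : r \notin writes divmod_cmd -> reg s1 r = reg s r by apply: reg_den.
have me1 : mem s1 = mem s by apply: mem_den.
have [] := @divmodP s; first by rewrite eB.
rewrite eB eG -/s1 => c1 dig quo; clearbody s1.
have r2 : ready C s2 by split; rewrite /s2 /= ?updE /= ?me1 ?fr1.
have [c2 [f2 b2]] := find_earliestP r2.
rewrite -/s3 in f2 b2.
have fr3 r : r \notin writes find_earliest -> reg s3 r = reg s2 r.
  exact: reg_den.
have me3 : mem s3 = mem s2 by apply: mem_den.
clearbody s3.
pose u := (end1 (get (earliest D TE C 0))).+1.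
have u4 : reg s4 vU = u by rewrite /s4 /= !updE /= addn1 /u -b2.
set d := g %% B in dig; have dB : d < B by rewrite ltn_pmod.
pose q i := iter i (try_next D TE u) (C, None).
have szq i : size (q i).1 = size C + i.
  by elim: i => [|i IH]; rewrite ?addn0 //= size_rcons IH addnS.
(* The guard [0 < i] is there because, before the first round, the registers still hold the earliest
   item found without a vertex condition. *)
pose I i s' := [/\ ready (q i).1 s', reg s' vTop = reg s' vL + 3 * (size C + i),
  reg s' vU = u /\ (0 < i -> holds s' (q i).2) &
  [seq reg s' r | r <- [:: vNC; vCTop; vBase; vCur; vOk]] =
  [seq reg s1 r | r <- [:: vNC; vCTop; vBase; vCur; vOk]]].
have [||i sa id [r5 t5 [u5 _] f5]|c5 [r5 t5 [u5 h5] f5]] :=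
  @forP try_cmd I (700 * ((size C + B) * X) + 60) d.+1 (EAdd $vDig #1) s4.
- by rewrite /s4 /= !updE /= fr3 // /s2 /= !updE /= dig addn1.
- split=> //.
  + by case: r2 => *; split; rewrite /s4 /= ?updE /= ?me3 ?fr3.
  + by rewrite /s4 /= !updE /= !fr3 // /s2 /= !updE /= addn0 !fr1.
  + by rewrite /s4 /= !updE /= !fr3.
- rewrite -szq in t5; have [c7 r7 h7 t7] := tryP r5 t5.
  rewrite u5 in r7 h7 t7.
  have qS : q i.+1 = try_next D TE u (q i) by [].
  split.
    apply: leq_trans c7 _; rewrite szq leq_add2r !leq_mul //; lia.
  split; rewrite ?qS //.
  + by rewrite t7 size_rcons szq addnS.
  + by rewrite reg_den.
  + rewrite -f5; apply/eq_in_map => r rI; apply: reg_den.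
    by move: r rI; apply/allP.
rewrite -/s5 in r5 t5 u5 h5 f5; clearbody s5.
have qd : (q d.+1).2 = candidate D TE C d by [].
rewrite qd in h5; case: (h5 isT) => f6 b6; set b := candidate _ _ _ _ in f6 b6.
case: f5 => n5 ct5 bs5 cu5 ok5.
have [E eE] : exists E, (q d.+1).1 = C ++ E by apply: try_next_prefix.
split.
  rewrite c6; rewrite [ecost _]/= in c5.
  (* Each of the [d.+1 <= B] rounds scans the input against at most [size C + B] items, hence costs
     a multiple of [Y]. *)
  have X0 : 0 < X by []. have SX : (size C).+1 * X <= (size C + B) * X.
    by rewrite leq_mul //; lia.
  have SB : (size C + B) * (B * X) = B * ((size C + B) * X) by rewrite mulnCA.
  move: SX SB c5 c2 c1; set Y := (size C + B) * X; set Y' := _.+1 * X.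
  set c' := cost _ s4; set c'' := cost _ s2; set c''' := cost _ s.
  move=> SX -> c5 c2 c1.
  have Y0 : 0 < Y by rewrite muln_gt0 X0 addn_gt0 B0 orbT.
  have : d.+1 * (700 * Y + 60 + 3) <= B * (763 * Y) by rewrite leq_mul //; lia.
  have : Y <= B * Y by rewrite leq_pmull.
  rewrite mulnCA; lia.
(* Forgetting the records leaves the chosen items [C] intact at the bottom of the stack. *)
have rC : ready C (set_reg s5 vNS (size C)).
  case: r5; rewrite eE item_cells_cat catA => ? /mem_at_cat[? _] *.
  by split; rewrite //= ?updE.
have := @ready_push C (get b) _ (reg s5 vCTop) rC.
case: r5 => m5 _ l5 _ d5.
have ct : reg s5 vCTop = reg s5 vL + 3 * size C by rewrite ct5 fr1 // eT l5 eL.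
rewrite ct => /(_ erefl); rewrite -ct.
have [-> -> ->] : [/\ end1 (get b) = reg s5 vBA, end2 (get b) = reg s5 vBB
  & time (get b) = reg s5 vBT] by rewrite -b6.
move=> mP.
have -> : extend D TE B (g, C, ok) = (g %/ B, rcons C (get b), ok && b) by [].
split.
- split; last exact: mP.
  rewrite /s6 /= !upd_neq ?m5 //; rewrite ct l5; lia.
- by split; rewrite /s6 /= !updE.
- by rewrite /= size_rcons /s6 /= !updE /= n5 ct fr1 // eN; split; lia.
- by rewrite /s6 /= !updE /= bs5 fr1.
- have okE : reg s6 vOk = eval s5 (EAnd $vOk $vF) by [].
  split; first by rewrite /s6 /= !updE /= cu5.
  by rewrite okE eval_and /= ok5 f6 fr1 // eO !lt0b.
Qed.

Lemma attempt_cmdP B g s : 0 < D ->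
  mem s 1 = size es -> mem_at (mem s) 4 (cells es) ->
  reg s vL = 4 + size (cells es) -> reg s vDelta = D -> reg s vBase = B ->
  reg s vGuess = g -> 2 * reg s vK <= B ->
  [/\ cost attempt_cmd s <=
       50 * ((reg s vK).+1 * g.+1) + 4100 * ((reg s vK).+1 * (B * (B * X))),
      reg (den attempt_cmd s) vAns = reg s vAns + attempt D TE B (reg s vK) g,
      reg (den attempt_cmd s) vGuess = g.+1 &
      mem_at (mem (den attempt_cmd s)) 4 (cells es) /\
      mem (den attempt_cmd s) 1 = size es].
Proof.
move=> D0 m1 m4 eL eD eB eg; set k := reg s vK => kB.
pose s1 := den (vCur <~ $vGuess ;; vOk <~ #1 ;; vNC <~ #0 ;; vCTop <~ $vL) s.
pose q i := iter i (extend D TE B) (g, [::], true).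
(* The rest of the guess never grows, so each division costs at most linear time in [g]. *)
have qg i : (q i).1.1 <= g /\ size (q i).1.2 = i.
  elim: i => [|i [IH1 IH2]] //=; case: (q i) IH1 IH2 => [[h C] ok] /= hg <-.
  by rewrite size_rcons (leq_trans (leq_div _ _)).
pose I i s' := search_state B (q i) s' /\ reg s' vAns = reg s vAns.
have [||i s' ik [i1 i2]|c1 [h1 h2]] :=
  @forP extend_cmd I (40 * g + 4000 * (B * (B * X))) k $vK s1.
- by [].
- split=> //; split=> //; rewrite /s1 /= ?updE //=.
    by rewrite cats0.
  by rewrite muln0 addn0.
- have B0 : 0 < B by lia.
  have [q1 q2] := qg i; have e : q i.+1 = extend D TE B (q i) by [].
  rewrite /I e; case: (q i) q1 q2 i1 {e} => [[h C] ok] q1 q2 i1.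
  have {}q1 : h <= g := q1; have {}q2 : size C = i := q2.
  have [c e] := extend_cmdP B0 i1; split; last first.
    by split=> //; rewrite reg_den.
  apply: leq_trans c _; apply: leq_add; first by rewrite leq_mul.
  (* Fewer than [k] items are chosen so far, and [2 * k <= B]. *)
  have : (size C + B) * (B * X) <= 2 * B * (B * X).
    by rewrite leq_mul2r; apply/orP; right; lia.
  move: (B * X) => Y; rewrite -mulnA.
  move: ((size C + B) * Y) (B * Y) => W Z. lia.
pose s2 := den (For $vK extend_cmd) s1.
have dE : den attempt_cmd s = den (vAns <~ EAdd $vAns $vOk ;; Incr vGuess 1)
   s2 by rewrite /attempt_cmd /s2 /s1 !den_Sq.
have cE : cost attempt_cmd s = 8 + (cost (For $vK extend_cmd) s1 + 8) by [].
have eg2 : reg s2 vGuess = g by rewrite /s2 reg_den.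
rewrite -/s2 in h1 h2; clearbody s2.
case: h1 => -[n1 n4] _ _ _ [_ ok]; rewrite dE cE; split.
- rewrite [ecost _]/= in c1.
  move: c1; move: (B * (B * X)) (cost _ s1) => Z c.
  by clear; lia.
- by rewrite !den_Sq /= !updE /= h2 ok.
- by rewrite !den_Sq /= !updE /= eg2 addn1.
- by split; [case/mem_at_cat: n4 | exact: n1].
Qed.
End SearchCommands.
Lemma cost_for0 e c s : eval s e = 0 -> cost (For e c) s = ecost e + 1.
Proof. by rewrite /= => ->. Qed.

(** * Enumeration of all guesses *)

Section Main.
Variables (es : seq input_edge) (D k : nat).
Let TE := items es.
Let X := (size es + size TE).+1.
Let B := 2 * k.
Let pow := B ^ k.

(** The first line pays for the power. Each of the [pow] attempts pays for divisions of a guess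
    below [pow] and for about [k * B] scans against at most [2 * B] items. *)
Definition search_bound : nat :=
  30 * (k.+1 * B.+1) + 10 +
  pow * (50 * (k.+1 * pow) + 4100 * (k.+1 * (B * (B * X))) + 3).

Lemma search_cmdP s : 0 < D ->
  mem s 1 = size es -> mem_at (mem s) 4 (cells es) ->
  reg s vL = 4 + size (cells es) -> reg s vDelta = D -> reg s vK = k ->
  cost search_cmd s <= search_bound /\
  reg (den search_cmd s) vAns =
    reg s vAns + \sum_(0 <= g < pow) attempt D TE B k g.
Proof.
move=> D0 m1 m4 eL eD eK; have [c1] := powerP s.
pose s1 := den power_cmd s.
have fr r : r \notin writes power_cmd -> reg s1 r = reg s r by apply: reg_den.
have me : mem s1 = mem s by apply: mem_den.
rewrite -/s1 eK => b1 p1; rewrite eK -/B in c1.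
pose s2 := den (vGuess <~ #0) s1.
have cE : cost search_cmd s =
  cost power_cmd s + (2 + cost (For $vPow attempt_cmd) s2) by [].
have dE : den search_cmd s = den (For $vPow attempt_cmd) s2.
  by rewrite /s2 /s1 /search_cmd !den_Sq.
rewrite dE cE; clear dE cE; clearbody s1.
pose I g s' := [/\ mem s' 1 = size es /\ mem_at (mem s') 4 (cells es),
  [seq reg s' r | r <- [:: vL; vDelta; vBase; vK]] =
     [:: 4 + size (cells es); D; B; k], reg s' vGuess = g &
  reg s' vAns = reg s vAns + \sum_(0 <= h < g) attempt D TE B k h].
have [||g s' gp [[n1 n4] [fL fD fB fK] eG eA]|c2 [_ _ _ h2]] :=
  @forP attempt_cmd I (50 * (k.+1 * pow) + 4100 * (k.+1 * (B * (B * X))))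
    pow $vPow s2.
- by rewrite /s2 /= !updE /= p1.
- split; rewrite /s2 /= ?updE /= ?me //.
    by rewrite b1 !fr // eL eD eK.
  by rewrite big_geq // addn0 fr.
- have kB : 2 * reg s' vK <= B by rewrite fK.
  have [c e eG' m] := attempt_cmdP D0 n1 n4 fL fD fB eG kB.
  rewrite fK in c e; split.
    apply: leq_trans c _; rewrite leq_add2r; apply: leq_mul => //.
    exact: leq_mul.
  split.
  + by case: m.
  + rewrite -[RHS]/[:: 4 + size (cells es); D; B; k] -fL -fD -fB -fK.
    by apply/eq_in_map => r rI; apply: reg_den; move: r rI; apply/allP.
  + exact: eG'.
  + by rewrite e eA big_nat_recr //= addnA.
- split; last exact: h2.
  rewrite [ecost _]/= in c2; rewrite /search_bound.
  by move: c1 c2; move: (pow * _) (k.+1 * _) => U V; clear; lia.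
Qed.

Lemma mainP n : let w := [:: n, size es, D, k & cells es] in
  cost main_cmd (ram_init w) <= search_bound + 100 * X + 100 /\
  (reg (den main_cmd (ram_init w)) vAns <> 0 <->
   if D == 0 then is_true (k <= size TE)
   else exists2 g, g < pow & attempt D TE B k g).
Proof.
move=> w; pose s1 :=
  den (vDelta <~ ELoad #2 ;; vK <~ ELoad #3 ;; vCnt <~ #0) (ram_init w).
pose s2 := den (scan (Incr vCnt 1)) s1.
pose s3 := den (vL <~ $vP ;;
  vAns <~ EAnd (EEq $vDelta #0) (ELt $vK (EAdd $vCnt #1))) s2.
have cE : cost main_cmd (ram_init w) = 3 + (3 + (2 +
  (cost (scan (Incr vCnt 1)) s1 + (2 + (26 +
   cost (For (ELt #0 $vDelta) search_cmd) s3))))) by [].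
have dE : den main_cmd (ram_init w) = den (For (ELt #0 $vDelta) search_cmd) s3.
  by rewrite /s3 /s2 /s1 /main_cmd !den_Sq.
rewrite cE dE; clear cE dE.
have m4 : mem_at (mem s1) 4 (cells es) by move=> i _.
pose I (l : seq item) s' := [/\ mem s' = mem s1, reg s' vDelta = D,
  reg s' vK = k & reg s' vCnt = size l].
have [|||||||||c1 [h1 h2 h3 h4] h5] :=
  @scanP (Incr vCnt 1) 4 es I _ _ _ _ _ _ s1.
- by [].
- by [].
- by [].
- by [].
- by move=> l s s' e r [i1 i2 i3 i4]; split; rewrite -?e -?r.
- move=> l s [i1 i2 i3 i4]; split=> //; split=> //.
  by rewrite size_rcons /= !updE /= i4 addn1.
- by [].
- by [].
- by [].
rewrite -/s2 in h1 h2 h3 h4 h5; clearbody s2.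
have A3 : reg s3 vAns = (D == 0) && (k <= size TE).
  have -> : reg s3 vAns = eval (den (vL <~ $vP) s2)
    (EAnd (EEq $vDelta #0) (ELt $vK (EAdd $vCnt #1))) by [].
  by rewrite !eval_bool /= !updE /= h2 h3 h4 addn1 ltnS.
have E3 : eval s3 (ELt #0 $vDelta) = (0 < D).
  by rewrite eval_lt /s3 /= !updE /= h2.
have [c3 ->] := for_bool search_cmd E3.
rewrite [ecost _]/= in c3.
case: (posnP D) => [D0|Dgt0].
  have c4 : cost (For (ELt #0 $vDelta) search_cmd) s3 <= 30.
    by rewrite cost_for0 // E3 D0.
  split; last by rewrite A3 D0 eqxx /=; case: leqP.
  by move: c1 c4; rewrite -/TE -/X; clear; lia.
have [||||| c5 d5] := @search_cmdP s3 Dgt0.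
- by rewrite /s3 /= h1.
- by rewrite /s3 /= h1.
- by rewrite /s3 /= !updE /= h5.
- by rewrite /s3 /= !updE /= h2.
- by rewrite /s3 /= !updE /= h3.
split; first by move: c1 c3 c5; rewrite -/TE -/X; clear; lia.
rewrite d5 A3 eqn0Ngt Dgt0 /= add0n; split.
  move=> /eqP; rewrite sum_nat_seq_neq0 => /hasP[g].
  by rewrite mem_index_iota /= eqb0 negbK => gp ag; exists g.
case=> g gp ag; apply/eqP; rewrite sum_nat_seq_neq0; apply/hasP.
by exists g; rewrite ?mem_index_iota ?ag.
Qed.

End Main.

(** * Bounding the cost by a power of [k] times the input length *)

Lemma exp_bound k : ((2 * k) ^ k) ^ 2 * k.+1 ^ 3 <= 32 * k ^ (7 * k).
Proof.
(* For [k = 0] both powers are [0 ^ 0 = 1]; for [k = 1] both sides equal 32, whence the constant. *)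
case: k => [|[|k]] //; set m := k.+2.
have m2 : 2 <= m by [].
(* The exponent 7 is twice the 2 of [h1] plus the 3 of [h2]. *)
have h1 : (2 * m) ^ m <= m ^ (2 * m).
  by rewrite expnM leq_exp2r // expnS expn1 leq_mul2r m2 orbT.
have h2 : m.+1 ^ 3 <= m ^ (3 * m).
  rewrite [3 * m]mulnC expnM leq_exp2r //.
  apply: leq_trans (_ : m ^ 2 <= _); first by rewrite /m; lia.
  by rewrite leq_pexp2l.
have -> : m ^ (7 * m) = (m ^ (2 * m)) ^ 2 * m ^ (3 * m).
  by rewrite -expnM -expnD; congr (_ ^ _); lia.
apply: leq_trans (leq_pmull _ _) => //; apply: leq_mul h2.
by rewrite leq_exp2r.
Qed.

Lemma search_bound_leq (es : seq input_edge) (k : nat) :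
  search_bound es k + 100 * (size es + size (items es)).+1 + 100 <=
  32 * (4 * 4200) * (k ^ (7 * k) * (size es + size (items es)).+1).
Proof.
set X := (_ + size (items es)).+1; set P := (2 * k) ^ k.
have P0 : 0 < P by rewrite /P; case: (k) => [|?] //; rewrite expn_gt0.
(* [U] dominates every summand; the coefficients add up to 60 + 10 + 50 + 16400 + 3 + 200 = 16723,
   which is below [4 * 4200]. *)
pose U := k.+1 ^ 3 * P ^ 2 * X.
have hU : U <= 32 * (k ^ (7 * k) * X).
  by rewrite mulnA /U leq_mul2r [k.+1 ^ 3 * _]mulnC exp_bound orbT.
have le a b c : a <= k.+1 ^ 3 -> b <= P ^ 2 -> c <= X -> a * b * c <= U.
  by move=> ha hb hc; rewrite /U !leq_mul.
have k3 : 0 < k.+1 ^ 3 by rewrite expn_gt0.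
have PP : P <= P ^ 2 by rewrite expnS expn1 leq_pmulr.
have P2 : 0 < P ^ 2 by rewrite expn_gt0 P0.
have t1 := le _ _ _ k3 P2 (isT : 0 < X).
have t2 := le _ _ _ k3 PP (isT : 0 < X).
have t3 := le _ _ _ k3 P2 (leqnn X).
have t4 := le _ _ _ (leqnn _) P2 (isT : 0 < X).
have t5 : k.+1 * P ^ 2 * 1 <= U.
  by apply: le => //; rewrite -[leqLHS]expn1 leq_pexp2l.
have t6 : k.+1 * k ^ 2 * P * X <= U.
  by apply: le => //; rewrite [leqRHS]expnS leq_mul2l leq_exp2r // leqnSn.
have e1 : k.+1 * (2 * k).+1 <= 2 * k.+1 ^ 3 by rewrite !expnS expn0; nia.
have e2 : P * (50 * (k.+1 * P) + 4100 * (k.+1 * (2 * k * (2 * k * X))) + 3) =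
    50 * (k.+1 * P ^ 2) + 4100 * (4 * (k.+1 * k ^ 2 * P * X)) + 3 * P.
  by rewrite !expnS !expn0; ring.
have -> : search_bound es k = 30 * (k.+1 * (2 * k).+1) + 10 +
    (50 * (k.+1 * P ^ 2) + 4100 * (4 * (k.+1 * k ^ 2 * P * X)) + 3 * P).
  by rewrite -e2.
move: hU t1 t2 t3 t4 t5 t6 e1; rewrite !mul1n !muln1.
move: (k.+1 * P ^ 2) (_ * P * X) (k.+1 ^ 3) (k.+1 * _.+1) (_ * X) => *.
lia.
Qed.

(** * Encoding of temporal graphs *)

Lemma distn_geq (D x y : nat) :
  (D <= `|x - y|) = ~~ ((x < y + D) && (y < x + D)).
Proof. lia. Qed.

(** This lifts a list of time edges, or of number triples, to listed oriented time edges. *)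
Lemma subset_map_preimage (S T : eqType) (f : S -> T) (s : seq S) (l : seq T) :
  {subset l <= map f s} -> exists2 l', {subset l' <= s} & map f l' = l.
Proof.
elim: l => [|y l IH] sl; first by exists [::].
have /mapP[x xs ->] : y \in map f s by apply: sl; rewrite mem_head.
have [|l' sl' <-] := IH; first by move=> z zl; apply: sl; rewrite inE zl orbT.
by exists (x :: l') => // z; rewrite inE => /orP[/eqP->|/sl'].
Qed.

Lemma uniq_map_inj_in (S T : eqType) (f : S -> T) (s : seq S) :
  uniq (map f s) -> {in s &, injective f}.
Proof.
elim: s => //= x s IH /andP[fx /IH inj] y z.
rewrite !inE => /orP[/eqP->|ys] /orP[/eqP->|zs] // e.
- by rewrite e map_f in fx.
- by rewrite -e map_f in fx.
- exact: inj.
Qed.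

Lemma setI2_eq0 (T : finType) (a b c d : T) :
  ([set a; b] :&: [set c; d] == set0) =
  ~~ [|| a == c, a == d, b == c | b == d].
Proof.
apply/idP/idP => [/eqP/setP H|H].
  apply/negP => h; have := H a; have := H b; rewrite !inE !eqxx orbT /=.
  by move=> h1 h2; move: h; rewrite orbA h1 h2.
apply/eqP/setP => x; rewrite !inE; apply/negP => /andP[].
by move=> /orP[] /eqP -> h; case/negP: H; rewrite orbA h ?orbT.
Qed.

Section Encoding.
Variables (G : temporal_graph) (es : seq ('I_(tg_n G) * 'I_(tg_n G))).
Hypothesis es_listing : edge_listing es.

Let vset (e : 'I_(tg_n G) * 'I_(tg_n G)) : {set 'I_(tg_n G)} := [set e.1; e.2].

Definition input_edges : seq input_edge :=
  [seq (val e.1, val e.2, tg_label (vset e)) | e <- es].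

(** A common source for both representations: [to_item] yields the triples of the program, and
    [to_time_edge] forgets the orientation. *)
Definition oriented_items : seq ('I_(tg_n G) * 'I_(tg_n G) * nat) :=
  flatten [seq [seq (e, t) | t <- tg_label (vset e)] | e <- es].

Definition to_item (p : 'I_(tg_n G) * 'I_(tg_n G) * nat) : item :=
  (val p.1.1, val p.1.2, p.2).

Definition to_time_edge (p : 'I_(tg_n G) * 'I_(tg_n G) * nat) :=
  (vset p.1, p.2).

Lemma instance_wordE Delta k : instance_word es Delta k =
  [:: tg_n G, size input_edges, Delta, k & cells input_edges].
Proof. by rewrite /instance_word /cells /input_edges size_map -map_comp. Qed.

Lemma items_input_edges : items input_edges = map to_item oriented_items.
Proof.
rewrite /items /input_edges /oriented_items map_flatten -!map_comp.
congr flatten; apply: eq_map => e /=.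
by rewrite /edge_items -map_comp.
Qed.

Lemma mem_vset e : e \in es -> vset e \in tg_edges G.
Proof.
by move=> ee; rewrite -mem_enum -(perm_mem es_listing); apply: map_f.
Qed.

Lemma items_loopless x : x \in items input_edges -> end1 x != end2 x.
Proof.
rewrite items_input_edges => /mapP[p /flatten_mapP[e ee /mapP[t _ ->]] ->].
rewrite /end1 /end2 /=; have := tg_edge_card (mem_vset ee).
by rewrite cards2; case: eqP => // /eqP; rewrite -val_eqE.
Qed.

Lemma map_to_time_edge : map to_time_edge oriented_items =
  [seq (E, t) | E <- map vset es, t <- tg_label E].
Proof.
rewrite /oriented_items map_flatten -!map_comp; congr flatten.
by apply: eq_map => e /=; rewrite -map_comp.
Qed.

(** Each edge is listed once and label lists are strictly ascending, so forgetting the orientation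
    identifies nothing. *)
Lemma uniq_to_time_edge : uniq (map to_time_edge oriented_items).
Proof.
have sub E : E \in map vset es -> E \in tg_edges G.
  by rewrite (perm_mem es_listing) mem_enum.
rewrite map_to_time_edge allpairs_uniq_dep //.
- by rewrite (perm_uniq es_listing) enum_uniq.
- move=> E /sub/tg_label_sorted; exact: (sorted_uniq ltn_trans ltnn).
- by move=> [E t] [E' t'] _ _ /= [-> ->].
Qed.

Lemma mem_to_time_edge q :
  (q \in map to_time_edge oriented_items) = time_edge q.
Proof.
case: q => E t; rewrite map_to_time_edge /time_edge /=.
have -> : (E \in tg_edges G) = (E \in map vset es).
  by rewrite (perm_mem es_listing) mem_enum.
apply/allpairsPdep/andP => [[E' [t' [h1 h2 [-> ->]]]]|[h1 h2]] //.
by exists E, t.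
Qed.

Lemma to_item_inj : injective to_item.
Proof. by move=> [[a b] t] [[c d] u] [/val_inj-> /val_inj-> ->]. Qed.

Lemma conf_to_item D p q : conf D (to_item p) (to_item q) =
  ((to_time_edge p).1 :&: (to_time_edge q).1 != set0) &&
  ~~ (D <= `|(to_time_edge p).2 - (to_time_edge q).2|).
Proof.
rewrite distn_geq negbK setI2_eq0 negbK /conf /share /at_vertex.
by rewrite andbA andbC /time /= -!val_eqE -!orbA.
Qed.

Lemma matching_yesP D k : 0 < D ->
  temporal_matching_yes G D k <->
  exists M, [/\ indep D M, {subset M <= items input_edges} & size M = k].
Proof.
move=> D0; rewrite items_input_edges; split=> [[M [[Mt Mm] kM]]|].
  (* Any [k] elements of a matching form a matching, which turns size at least [k] into size exactly
     [k]. *)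
  have [|L sL eL] := @subset_map_preimage _ _ to_time_edge oriented_items
    (take k (enum_fset M)).
    by move=> q /mem_take qM; rewrite mem_to_time_edge; apply: Mt.
  have uL : uniq (map to_time_edge L) by rewrite eL take_uniq ?fset_uniq.
  have inM p : p \in L -> to_time_edge p \in M.
    by move=> pL; apply: (@mem_take k); rewrite -eL map_f.
  exists (map to_item L); split.
  - split; first by rewrite (map_inj_uniq to_item_inj) (map_uniq uL).
    move=> _ _ /mapP[p pL ->] /mapP[q qL ->].
    rewrite (inj_eq to_item_inj) => pq.
    rewrite conf_to_item negb_and negbK.
    have [|||->|->] := Mm (to_time_edge p) (to_time_edge q);
      rewrite ?eqxx ?orbT //.
    + exact: inM.
    + exact: inM.
    + by move/(uniq_map_inj_in uL pL qL)/eqP; rewrite (negPf pq).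
  - by move=> _ /mapP[p /sL pL ->]; apply: map_f.
  - by rewrite size_map -(size_map to_time_edge) eL size_takel.
case=> M [[uM iM] sM szM].
have [L sL eL] := subset_map_preimage sM.
(* Two different items with the same time edge would share an end point and a time, hence conflict,
   as [D] is positive. *)
have inj : {in L &, injective to_time_edge}.
  move=> p q pL qL e; apply/eqP; apply/idPn => pq.
  have /negP[] : ~~ conf D (to_item p) (to_item q).
    by apply: iM; rewrite -?eL ?map_f // (inj_eq to_item_inj).
  rewrite conf_to_item e distn_geq negbK; apply/andP; split; last by lia.
  by apply/set0Pn; exists q.1.1; rewrite !inE eqxx.
have uL : uniq (map to_time_edge L).
  by rewrite (map_inj_in_uniq inj) (map_uniq (f := to_item)) // eL.
exists [fset q in map to_time_edge L]%fset; split; last first.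
  rewrite card_fseq undup_id // size_map -szM -eL size_map.
  exact: leqnn.
split=> [q|q r]; rewrite !inE.
  by move=> /mapP[p /sL pL ->]; rewrite -mem_to_time_edge map_f.
move=> /mapP[p pL ->] /mapP[p' pL' ->] ne.
have : ~~ conf D (to_item p) (to_item p').
  apply: iM; rewrite -?eL ?map_f // (inj_eq to_item_inj).
  by apply/eqP => e; case: ne; rewrite e.
rewrite conf_to_item negb_and !negbK => /orP[/eqP|]; [by left | by right].
Qed.

Lemma matching_yes0 k :
  temporal_matching_yes G 0 k <-> k <= size (items input_edges).
Proof.
rewrite items_input_edges size_map -(size_map to_time_edge); split.
  case=> M [[Mt _] kM]; apply: leq_trans kM _; apply: uniq_leq_size.
    exact: fset_uniq.
  by move=> q qM; rewrite mem_to_time_edge; apply: Mt.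
move=> kM; exists [fset q in map to_time_edge oriented_items]%fset; split.
  split=> [q|q r]; last by right.
  by rewrite !inE mem_to_time_edge.
by rewrite card_fseq undup_id ?uniq_to_time_edge.
Qed.

(** Label sets are nonempty, so every edge contributes a time edge. *)
Lemma size_input_edges : size input_edges <= size (items input_edges).
Proof.
rewrite size_items /input_edges size_map -map_comp.
have : {in es, forall e, 0 < size (tg_label (vset e))}.
  by move=> e /mem_vset/tg_label_neq0; case: tg_label.
elim: (es) => //= e l IH pos; rewrite -addn1 addnC leq_add //.
  by apply: pos; rewrite mem_head.
by apply: IH => x xl; apply: pos; rewrite inE xl orbT.
Qed.

Lemma size_items_leq : size (items input_edges) <= tg_size G.
Proof.
have layerE t : #|layer G t| = \sum_(E in tg_edges G) (t \in tg_label E).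
  rewrite -sum1_card big_mkcond [RHS]big_mkcond; apply: eq_bigr => E _.
  by rewrite inE; case: (E \in _); case: (t \in _).
rewrite items_input_edges size_map -(size_map to_time_edge) map_to_time_edge.
rewrite size_allpairs_dep sumnE big_map (perm_big _ es_listing) /= big_enum /=.
apply: leq_trans (leq_addl _ _).
under [leqRHS]eq_bigr do rewrite layerE.
(* Double counting: summed per edge instead of per layer, it suffices that the labels of an edge lie
   between 1 and the lifetime. *)
rewrite exchange_big; apply: leq_sum => E EG /=.
have -> : \sum_(1 <= t < (lifetime G).+1) (t \in tg_label E) =
    size [seq t <- index_iota 1 (lifetime G).+1 | t \in tg_label E].
  rewrite size_filter -sum1_count [RHS]big_mkcond.
  by apply: eq_bigr => t _; case: (t \in _).
apply: uniq_leq_size.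
  exact: (sorted_uniq ltn_trans ltnn) (tg_label_sorted EG).
move=> t tE; rewrite mem_filter tE mem_index_iota (tg_label_pos EG tE) ltnS /=.
pose F (e : {set 'I_(tg_n G)}) := \max_(u <- tg_label e) u.
apply: leq_trans (leq_bigmax_cond (F := F) _ EG).
exact: (leq_bigmax_seq (F := id)).
Qed.

End Encoding.

(** * Assembling the decision procedure and its running time *)

Theorem theorem4p4 :
  exists (P : ram_prog) (c : nat),
    forall (G : temporal_graph) (es : seq ('I_(tg_n G) * 'I_(tg_n G)))
           (Delta k : nat),
      edge_listing es ->
      decides_within P (instance_word es Delta k)
        (temporal_matching_yes G Delta k)
        (c * k ^ (c * k) * maxn 1 (tg_size G)).
Proof.
have [A boundA] : exists A, forall es k,
    search_bound es k + 100 * (size es + size (items es)).+1 + 100 <=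
    A * (k ^ (7 * k) * (size es + size (items es)).+1).
  by eexists; exact: search_bound_leq.
(* The factor 3 comes from [size ies + size (items ies) + 1 <= 3 * maxn 1 (tg_size G)], and the
   summand 7 from the exponent [7 * k]. *)
exists (compile main_cmd num_vars), (3 * A + 7) => G es Delta k es_listing.
rewrite instance_wordE; set ies := input_edges es; set w := [:: _, _, _, _ & _].
have [cost_le ansP] := mainP ies Delta k (tg_n G); rewrite -/w in cost_le ansP.
have [s [exec_s [reg_s _] _]] :=
  @compileP num_vars main_cmd (ram_init w) num_vars (ram_init w) main_wf
    (leqnn _) (conj (fun _ _ => erefl) (fun=> erefl)).
exists (cost main_cmd (ram_init w)), s; split=> //.
- apply: leq_trans cost_le _; apply: leq_trans (boundA ies k) _.
  have sz1 := size_input_edges es_listing.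
  have sz2 := size_items_leq es_listing.
  have -> : (3 * A + 7) * k ^ ((3 * A + 7) * k) * maxn 1 (tg_size G) =
      (3 * A + 7) * (k ^ ((3 * A + 7) * k) * maxn 1 (tg_size G)).
    by rewrite mulnA.
  apply: (@leq_trans (A * (k ^ (7 * k) * (3 * maxn 1 (tg_size G))))).
    by rewrite !leq_mul //; rewrite -/ies in sz1 sz2; lia.
  have -> : A * (k ^ (7 * k) * (3 * maxn 1 (tg_size G))) =
      3 * A * (k ^ (7 * k) * maxn 1 (tg_size G)) by ring.
  (* Monotonicity in the exponent needs a positive base, so [k = 0] is treated apart; there both
     exponents are 0. *)
  rewrite !leq_mul ?leq_addr //; case: (k) => [|k'].
    by rewrite !muln0.
  by rewrite leq_pexp2l // leq_mul // leq_addl.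
- rewrite reg_s // ansP; case: (posnP Delta) => [-> /=|Delta_gt0].
    by split=> /(matching_yes0 es_listing).
  split.
    move=> /(attemptP Delta_gt0 (items_loopless es_listing) (leqnn _)).
    by move/(matching_yesP es_listing k Delta_gt0).
  move=> /(matching_yesP es_listing k Delta_gt0).
  by move/(attemptP Delta_gt0 (items_loopless es_listing) (leqnn _)).
Qed.
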